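(* There is a constant $c$ such that the following holds. Let $\mathcal{G}$ be a finite stochastic game with $n$ vertices and vertex set $V$, let $\Omega_1:V\to\mathbb{N}$ with largest value $d_1$, and let $\Omega_2:V\to\{1,2\}$ (a Büchi condition). If Player 1 has a strategy from a vertex $v$ that is sure winning for $\mathsf{Parity}(\Omega_1)$ and almost-sure winning for $\mathsf{Parity}(\Omega_2)$, then Player 1 has such a strategy from $v$ that uses finite memory of size at most $c\cdot n\cdot\max(d_1,1)$ (i.e., memory of size $O(n\cdot d_1)$).
   Context: A stochastic game $\langle V,(V_1,V_2,V_\Diamond),E,\delta\rangle$ has a finite vertex set $V$ partitioned into Player-1, Player-2 and probabilistic vertices, edges $E\subseteq V\times V$ with every vertex having a successor, and $\delta:V_\Diamond\to\mathcal{D}(V)$ giving for each probabilistic vertex a distribution whose support is exactly its successor set. A strategy for Player $i$ maps histories (finite paths) ending in $V_i$ to a successor of the last vertex. A strategy uses finite memory of size $m$ if there is a right congruence on histories with $m$ classes (equivalently, a finite-state transducer with $m$ memory states) such that equivalent histories receive the same choice. $\mathsf{Out}(v,\sigma_1)$ is the set of plays from $v$ consistent with $\sigma_1$, and $\mathsf{Pr}_v^{\sigma_1,\sigma_2}$ is the induced probability measure. $\mathsf{Parity}(\Omega)$ is the set of plays $v_0v_1\dots$ with $\limsup_j\Omega(v_j)$ even (for $\Omega$ into $\{1,2\}$ this means priority 2 is visited infinitely often). $\sigma_1$ is sure winning for $\psi$ from $v$ if $\mathsf{Out}(v,\sigma_1)\subseteq\psi$, and almost-sure winning if $\mathsf{Pr}_v^{\sigma_1,\sigma_2}(\psi)=1$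 for all Player-2 strategies $\sigma_2$. *)

(* Defs.v *)
From HB Require Import structures.
From mathcomp Require Import all_boot all_order all_algebra.
From mathcomp Require Import all_classical all_reals all_analysis.
Set Implicit Arguments. Unset Strict Implicit. Unset Printing Implicit Defensive.
Import Order.TTheory GRing.Theory Num.Theory.
Local Open Scope classical_set_scope.
Local Open Scope ring_scope.

Inductive player := Player1 | Player2 | Random.

Definition stoch_game (R : realType) (V : finType) (owner : V -> player)
  (E : rel V) (delta : V -> V -> R) : Prop :=
  (forall u, exists x, E u x) /\
  (forall u, owner u = Random ->
     (forall x, 0 <= delta u x) /\ (forall x, (0 < delta u x) = E u x) /\
     \sum_(x : V) delta u x = 1).

(* A (pure) strategy: given the history  rcons pre u  (pre = the vertices
   before the current vertex u), it returns a successor of u.  Only its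
   values at vertices of the owning player matter. *)
Definition strategy (V : finType) := seq V -> V -> V.

Definition valid_strategy (V : finType) (owner : V -> player) (E : rel V)
  (p : player) (s : strategy V) : Prop :=
  forall pre u, owner u = p -> E u (s pre u).

(* Plays are infinite sequences of vertices; the type is tagged by a point
   v0 only to carry a pointedType instance (needed by the measure library). *)
Definition play (V : finType) (v0 : V) := nat -> V.
Section PlayPointed.
Variables (V : finType) (v0 : V).
HB.instance Definition _ := Choice.on (@play V v0).
HB.instance Definition _ := isPointed.Build (@play V v0) (fun _ => v0).
End PlayPointed.

Definition prefix (V : finType) (w : nat -> V) (i : nat) : seq V :=
  [seq w j | j <- iota 0 i].

Definition Out (V : finType) (owner : V -> player) (E : rel V)
  (s1 : strategy V) (v : V) : set (nat -> V) :=
  [set w | w 0%N = v /\ forall i, E (w i) (w i.+1) /\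
      (owner (w i) = Player1 -> w i.+1 = s1 (prefix w i) (w i))].

Definition Parity (V : finType) (Om : V -> nat) : set (nat -> V) :=
  [set w | exists p : nat, ~~ odd p /\
     (forall N, exists i, (N <= i)%N /\ Om (w i) = p) /\
     (exists N, forall i, (N <= i)%N -> (Om (w i) <= p)%N)].

Definition cyl (V : finType) (v0 : V) (h : seq V) : set (@play V v0) :=
  [set w | forall i, (i < size h)%N -> w i = nth (w i) h i].

Definition cylinders (V : finType) (v0 : V) : set (set (@play V v0)) :=
  range (@cyl V v0).

Definition step (R : realType) (V : finType) (owner : V -> player)
  (delta : V -> V -> R) (s1 s2 : strategy V) (pre : seq V) (u x : V) : R :=
  match owner u with
  | Player1 => (s1 pre u == x)%:R
  | Player2 => (s2 pre u == x)%:R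
  | Random => delta u x
  end.

Definition prefprob (R : realType) (V : finType) (owner : V -> player)
  (delta : V -> V -> R) (s1 s2 : strategy V) (v : V) (h : seq V) : R :=
  match h with
  | [::] => 1
  | u :: t => (u == v)%:R *
      \prod_(i < size t)
        step owner delta s1 s2 (take i (u :: t)) (nth u (u :: t) i) (nth u t i)
  end.

(* Pr_v^{s1,s2}: any probability measure on the cylinder sigma-algebra that
   agrees with the transition probabilities on cylinders (it is unique). *)
Definition is_Pr (R : realType) (V : finType) (owner : V -> player)
  (delta : V -> V -> R) (s1 s2 : strategy V) (v : V)
  (P : probability (g_sigma_algebraType (@cylinders V v)) R) : Prop :=
  forall h : seq V, P (@cyl V v h) = (prefprob owner delta s1 s2 v h)%:E.

Definition sure_winning (V : finType) (owner : V -> player) (E : rel V)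
  (s1 : strategy V) (v : V) (psi : set (nat -> V)) : Prop :=
  Out owner E s1 v `<=` psi.

Definition almost_sure_winning (R : realType) (V : finType)
  (owner : V -> player) (E : rel V) (delta : V -> V -> R)
  (s1 : strategy V) (v : V) (psi : set (nat -> V)) : Prop :=
  forall s2 : strategy V, valid_strategy owner E Player2 s2 ->
  forall P : probability (g_sigma_algebraType (@cylinders V v)) R,
    @is_Pr R V owner delta s1 s2 v P -> P psi = 1%E.

Definition uses_memory_at_most (V : finType) (owner : V -> player)
  (s1 : strategy V) (m : nat) : Prop :=
  exists (M : finType) (m0 : M) (up : M -> V -> M) (nxt : M -> V -> V),
    (#|M| <= m)%N /\
    forall pre u, owner u = Player1 -> s1 pre u = nxt (foldl up m0 pre) u.

(* Main.v *)
Require Import Defs.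
From HB Require Import structures.
From mathcomp Require Import all_boot all_order all_algebra.
From mathcomp Require Import all_classical all_reals all_analysis.
From mathcomp Require Import zify ring lra.
Set Implicit Arguments. Unset Strict Implicit. Unset Printing Implicit Defensive.

(** Reduce to a finite parity game.  At a random vertex Player 2 either lets
    Player 1 pick the successor or picks it herself; the second option counts as
    a visit to priority 2 of [Om2].  Remembering the maximal [Om1] since the last
    such visit turns the conjunction of the two objectives into one parity
    condition, so one of the players wins with a positional strategy.

    If Player 1 wins, he simulates the product game along the real history,
    treating a random move as Player 2's iff it differs from the move he would
    have picked himself; to detect this he must remember the previous product
    position, whence the factor [n] in the memory.  The sure objective is
    immediate.  As long as chance agrees with his predictions a rank decreases
    towards priority 2, so an exponential potential of the rank contracts and
    priority 2 is almost surely seen again and again.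

    If Player 2 wins, then against a surely winning [s1] her strategy leaves a
    finite history after which no visit to priority 2 (real or counted) is
    possible; that history has positive probability, so [s1] is not almost-surely
    winning.  This last step needs the measure on plays to exist, and it is
    obtained by reading a play off a uniform real in [0, 1[. *)

(** * Limit superior of bounded sequences of naturals *)

Definition limsup_is (s : nat -> nat) (q : nat) : Prop :=
  (forall N, exists2 n, (N <= n)%N & s n = q) /\
  (exists N, forall n, (N <= n)%N -> (s n <= q)%N).

Lemma limsup_is_unique s q q' : limsup_is s q -> limsup_is s q' -> q = q'.
Proof.
move=> [io [N le]] [io' [N' le']].
have [n Nn sn] := io N'; have [n' Nn' sn'] := io' N.
by apply/eqP; rewrite eqn_leq -{1}sn le' // -sn' le.
Qed.

Lemma limsup_is_tail s q N : limsup_is (fun n => s (N + n)) q -> limsup_is s q.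
Proof.
move=> [io [M le]]; split=> [K|].
  by have [n Kn sn] := io K; exists (N + n) => //; lia.
exists (N + M) => n Nn; have -> : n = N + (n - N) by lia.
by apply: le; lia.
Qed.

(** Either the bound is attained infinitely often, and is then the limsup, or it can be lowered by
    one. The bound is first weakened to an eventual one so that this descent is an induction. *)
Lemma limsup_is_exists s d : (forall n, s n <= d) -> exists q, limsup_is s q.
Proof.
move=> sd; have {sd} : exists N, forall n, N <= n -> s n <= d by exists 0.
elim: d => [|d IHd] [N le].
  exists 0; split=> [M|]; last by exists N.
  by exists (M + N); [lia | apply/eqP; rewrite -leqn0 le //; lia].
have [io|/asboolPn] := pselect (forall M, exists2 n, M <= n & s n = d.+1).
  by exists d.+1; split=> //; exists N.
move=> /asboolPn /existsNP[M noM]; apply: IHd; exists (M + N) => n Mn.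
have := le n ltac:(lia); rewrite leq_eqVlt => /orP[/eqP sn|//].
by case: noM; exists n => //; lia.
Qed.

(** * Positional determinacy of parity games *)

Section ParityGame.
Import mathcomp.boot.fintype mathcomp.boot.finset.
Variables (X : finType) (e : rel X) (o : X -> bool) (p : X -> nat).
Implicit Types (S T W A : {set X}) (f : X -> X) (w : nat -> X).

(* A player is identified with the parity that player wants the limsup to have. *)
Definition pwin (i : bool) w := exists2 q, odd q = i & limsup_is (p \o w) q.

Definition follows (i : bool) f W w :=
  forall n, [/\ w n \in W, e (w n) (w n.+1) & o (w n) = i -> w n.+1 = f (w n)].

(** Besides being won by [i], the region is a trap for the opponent inside [S]: a play that stays in
    [S] and obeys [f] never leaves [W]. This is why [follows] may demand membership in [W] at every
    step. *)
Definition win_region (i : bool) S W f :=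
  [/\ W \subset S,
      forall x, x \in W -> o x = i -> e x (f x) /\ f x \in W,
      forall x y, x \in W -> o x = ~~ i -> e x y -> y \in S -> y \in W &
      forall w, follows i f W w -> pwin i w].

Definition subarena S := forall x, x \in S -> exists2 y, y \in S & e x y.

Lemma pwin_tail i w N : pwin i (fun n => w (N + n)) -> pwin i w.
Proof. by case=> q qi lq; exists q => //; apply: limsup_is_tail lq. Qed.

(** From [A] player [i] forces a visit to [T], with [r] as the decreasing distance. The last clauses
    say that [i] cannot enter [A] from outside and that the opponent can always stay outside, so the
    complement is again a subarena. The set is grown one vertex at a time, by induction on what
    remains of [S]. *)
Lemma attractor i S T : T \subset S -> exists A (r : X -> nat) (a : X -> X),
  [/\ T \subset A, A \subset S,
      forall x, x \in A -> x \notin T -> o x = i ->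
        [/\ e x (a x), a x \in A & r (a x) < r x],
      forall x y, x \in A -> x \notin T -> o x = ~~ i -> e x y -> y \in S ->
        y \in A /\ r y < r x &
      (forall x y, x \in S -> x \notin A -> o x = i -> y \in A -> ~~ e x y) /\
      (forall x, x \in S -> x \notin A -> o x = ~~ i ->
        exists2 y, y \in S :\: A & e x y)].
Proof.
have nij : (~~ i == i) = false by case: (i).
move: {2}(#|S :\: T|) (leqnn #|S :\: T|) => n.
elim: n T => [|n IHn] T cardT TS.
  have ST : S \subset T by rewrite -setD_eq0 -cards_eq0 -leqn0.
  exists T, (fun=> 0), id; split=> //; first by move=> x ->.
    by move=> x y ->.
  by split=> [x y|x] /(subsetP ST) ->.
pose P x := [&& x \in S, x \notin T &
  if o x == i then [exists y in T, e x y] else [forall y in S, e x y ==> (y \in T)]].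
case: (pickP P) => [x /and3P[xS xT Px]|noP]; last first.
  exists T, (fun=> 0), id; split=> //; first by move=> x ->.
    by move=> x y ->.
  split=> [x y xS xT oi yT|x xS xT oi].
    have := noP x; rewrite /P xS xT oi eqxx /= => /negbT.
    by rewrite negb_exists_in => /forall_inP /(_ y yT).
  have := noP x; rewrite /P xS xT oi nij /=.
  move=> /negbT; rewrite negb_forall_in => /exists_inP[y yS].
  by rewrite negb_imply => /andP[exy yT]; exists y; rewrite // inE yT.
have [||A [r [a [TA AS Ai Aj [Ci Cj]]]]] := IHn (x |: T).
- rewrite -ltnS; apply: leq_trans cardT; apply: proper_card.
  apply/properP; split; first by apply: setDS; apply: subsetUr.
  by exists x; rewrite !inE ?xS ?xT // eqxx.
- by apply/subsetP=> y /setU1P[->//|/(subsetP TS)].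
pose x' := odflt x [pick y in T | e x y].
(* The inductive rank descends only outside [x |: T]. Shifting it by two puts all those vertices
   above [T] (rank 0) and the newly absorbed [x] (rank 1). *)
pose r' y := if y \in T then 0 else if y == x then 1 else (r y).+2.
have TA' : T \subset A by apply: subset_trans TA; apply: subsetUr.
have r'T y : y \in T -> r' y = 0 by rewrite /r' => ->.
have r'lt y z : y \notin x |: T -> r z < r y -> r' z < r' y.
  rewrite /r' !inE negb_or => /andP[/negbTE-> /negbTE->].
  by case: ifP => // _; case: ifP.
exists A, r', (fun y => if y == x then x' else a y); split=> //.
- move=> y yA yT oy; have [eyx|nyx] := eqVneq y x.
    subst y; move: Px; rewrite oy eqxx => /exists_inP[z zT exz].
    rewrite /x'; case: pickP => [y /andP[yT' exy]|/(_ z)]; last by rewrite zT exz.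
    by split=> //; [apply: (subsetP TA')|rewrite r'T // /r' (negbTE xT) eqxx].
  have yxT : y \notin x |: T by rewrite !inE negb_or nyx.
  by have [e1 e2 e3] := Ai y yA yxT oy; split=> //; apply: r'lt.
- move=> y z yA yT oy eyz zS; have [eyx|nyx] := eqVneq y x.
    subst y; move: Px; rewrite oy nij.
    move=> /forall_inP /(_ z zS) /implyP /(_ eyz) zT.
    by split; [apply: (subsetP TA')|rewrite r'T // /r' (negbTE xT) eqxx].
  have yxT : y \notin x |: T by rewrite !inE negb_or nyx.
  by have [e1 e2] := Aj y z yA yxT oy eyz zS; split=> //; apply: r'lt.
Qed.

(* Zielonka's recursion on the maximal priority [d] of the subarena. *)
Theorem parity_determined S : subarena S ->
  exists (W : bool -> {set X}) (f : bool -> X -> X),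
    (forall i, win_region i S (W i) (f i)) /\ W false :|: W true = S.
Proof.
move: {2}(#|S|) (leqnn #|S|) => n; elim: n S => [|n IHn] S cardS arS.
  have -> : S = set0 by apply/eqP; rewrite -cards_eq0 -leqn0.
  exists (fun=> set0), (fun=> id); rewrite setU0; split=> // i.
  split; try by move=> x; rewrite inE.
  - exact: sub0set.
  - by move=> w /(_ 0)[]; rewrite inE.
have [S0|/set0Pn[x0 x0S]] := eqVneq S set0.
  by apply: IHn; rewrite // S0 cards0.
pose d := \max_(x in S) p x.
have [xd xdS pxd] : {x | x \in S & d = p x}.
  by apply: eq_bigmax_cond; apply/card_gt0P; exists x0.
have pd x : x \in S -> p x <= d by move=> xS; apply: leq_bigmax_cond.
pose i := odd d; pose D := [set x in S | p x == d].
have DS : D \subset S by apply/subsetP=> x; rewrite inE => /andP[].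
have [A [r [a [DA AS Ai Aj [Ci Cj]]]]] := attractor i DS.
have smaller (B : {set X}) : B \subset S -> B != set0 -> #|S :\: B| <= n.
  move=> BS B0; rewrite -ltnS; apply: leq_trans cardS.
  rewrite cardsD (setIidPr BS) -subn_gt0 subKn ?subset_leq_card //.
  by rewrite card_gt0.
have comp_ar (j : bool) (B : {set X}) : B \subset S ->
  (forall x y, x \in S -> x \notin B -> o x = j -> y \in B -> ~~ e x y) ->
  (forall x, x \in S -> x \notin B -> o x = ~~ j -> exists2 y, y \in S :\: B & e x y) ->
  subarena (S :\: B).
  move=> BS B1 B2 x; rewrite inE => /andP[xB xS].
  have [oxj|nj] := eqVneq (o x) j.
    have [y yS exy] := arS x xS; exists y => //; rewrite inE yS andbT.
    by apply/negP => /(B1 _ _ xS xB oxj); rewrite exy.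
  by apply: B2 => //; move: nj; case: (o x) (j) => -[].
have ojN x : o x != i -> o x = ~~ i by case: (o x) (i) => -[].
have [|W' [f' [reg' cov']]] := IHn (S :\: A) _ (comp_ar i A AS Ci Cj).
  apply: smaller => //; apply/set0Pn; exists xd; apply: (subsetP DA).
  by rewrite inE xdS pxd eqxx.
have cov'' : W' i :|: W' (~~ i) = S :\: A.
  by rewrite -cov'; case: (i) => //; rewrite setUC.
(* If the opponent wins nothing outside the attractor of the top priority, [i] wins all of [S]. *)
have [W'0|W'0] := eqVneq (W' (~~ i)) set0.
  rewrite W'0 setU0 in cov''.
  have [_ reg'1 reg'2 reg'3] := reg' i.
  pose sx x := odflt x [pick y in S | e x y].
  have sxP x : x \in S -> e x (sx x) /\ sx x \in S.
    move=> xS; rewrite /sx; case: pickP => [y /andP[]//|no].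
    by have [y yS exy] := arS x xS; have := no y; rewrite yS exy.
  pose F x := if x \in D then sx x else if x \in A then a x else f' i x.
  exists (fun j => if j == i then S else set0), (fun j => if j == i then F else id).
  split; last by case: (i); rewrite /= ?setU0 ?set0U.
  move=> j; have [->|_] := eqVneq j i; last first.
    split; try by move=> x; rewrite inE.
    - exact: sub0set.
    - by move=> w /(_ 0)[]; rewrite inE.
  split=> // [x xS oxi|w fw].
    rewrite /F; case: ifP => [_|/negbT xD]; first exact: sxP.
    case: ifP => [xA|/negbT xA].
      by have [e1 /(subsetP AS) e2 _] := Ai x xA xD oxi.
    have xW : x \in W' i by rewrite cov'' inE xA.
    by have [e1] := reg'1 x xW oxi; rewrite cov'' inE => /andP[_ e2].
  (* Either the play eventually avoids [A], and its tail is a play of the smaller game won by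
     [f' i], or it enters [A] infinitely often and each time is driven to priority [d], which has
     the parity of [i]. *)
  have [io|/asboolPn] := pselect (forall N, exists2 n, N <= n & w n \in A); last first.
    move=> /asboolPn/existsNP[N noN]; apply: (@pwin_tail _ _ N).
    have nA m : N <= m -> w m \notin A by move=> Nm; apply/negP=> wA; apply: noN; exists m.
    apply: reg'3 => m; have [w1 w2 w3] := fw (N + m).
    rewrite addnS; split=> //; first by rewrite cov'' inE w1 nA // leq_addr.
    move=> /w3 ->; rewrite /F; have wA := nA (N + m) (leq_addr _ _).
    by rewrite (contraNF (subsetP DA _) wA) (negbTE wA).
  have reach k m : r (w m) < k -> w m \in A -> exists2 m', m <= m' & w m' \in D.
    elim: k m => // k IHk m rk wA.
    have [wD|wD] := boolP (w m \in D); first by exists m.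
    have [w1 w2 w3] := fw m; have [w1' _ _] := fw m.+1.
    have [||m' mm' m'D] := IHk m.+1; last by exists m' => //; apply: ltnW.
    - have [oi|/ojN oi] := eqVneq (o (w m)) i.
        have [_ _ lt] := Ai _ wA wD oi; rewrite w3 // /F (negbTE wD) wA.
        exact: leq_trans lt rk.
      by have [_ lt] := Aj _ _ wA wD oi w2 w1'; apply: leq_trans lt rk.
    - have [oi|/ojN oi] := eqVneq (o (w m)) i.
        by rewrite w3 // /F (negbTE wD) wA; have [] := Ai _ wA wD oi.
      by have [] := Aj _ _ wA wD oi w2 w1'.
  exists d => //; split=> [N|]; last by exists 0 => m _; apply: pd; have [] := fw m.
  have [m Nm mA] := io N; have [m' mm'] := reach _ m (leqnn _) mA.
  by rewrite inE => /andP[_ /eqP pm']; exists m' => //; apply: leq_trans mm'.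
(* Otherwise the opponent's region of the smaller game is also winning in [S]. Its attractor [B] is
   removed and the recursion is applied to the rest, whose regions, with [B] added to the
   opponent's, are the answer. *)
have [W'S reg'1 reg'2 reg'3] := reg' (~~ i).
have W'SS : W' (~~ i) \subset S by apply: subset_trans W'S _; apply: subsetDl.
have [B [rB [b [WB BS Bi Bj [CBi CBj]]]]] := attractor (~~ i) W'SS.
have [|W'' [f'' [reg'' cov3]]] := IHn (S :\: B) _ (comp_ar _ B BS CBi CBj).
  by apply: smaller => //; apply: contraNneq W'0 => B0; rewrite -subset0 -B0.
pose G x := if x \in W' (~~ i) then f' (~~ i) x else if x \in B then b x else f'' (~~ i) x.
exists (fun j => if j == i then W'' i else W'' (~~ i) :|: B),
       (fun j => if j == i then f'' i else G); split; last first.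
  have -> : S = W'' i :|: (W'' (~~ i) :|: B).
    rewrite setUA -[S in LHS](setID S B) (setIidPr BS) -cov3 setUC.
    by case: (i) => //; rewrite /= (setUC (W'' false)).
  by case: (i) => //=; rewrite setUC.
move=> j; have [->|nji] := eqVneq j i.
  have [r1 r2 r3 r4] := reg'' i; split=> //.
    by apply: subset_trans r1 _; apply: subsetDl.
  move=> x y xW ox exy yS; apply: (r3 x) => //; rewrite inE yS andbT.
  have := subsetP r1 x xW; rewrite inE => /andP[xB xS].
  by apply/negP=> /(CBi _ _ xS xB ox); rewrite exy.
have -> : j = ~~ i by move: nji; case: (j) (i) => -[].
have [r1 r2 r3 r4] := reg'' (~~ i); rewrite negbK in reg'2 Bj r3 CBj.
have W''SB x : x \in W'' (~~ i) -> x \in S /\ x \notin B.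
  by move=> /(subsetP r1); rewrite inE => /andP[].
have W'SA x : x \in W' (~~ i) -> x \in S /\ x \notin A.
  by move=> /(subsetP W'S); rewrite inE => /andP[].
(* Player [i] has no edge from outside [A] into [A], so leaving [S :\: A] offers no escape. *)
have W'closed x y : x \in W' (~~ i) -> o x = i -> e x y -> y \in S -> y \in W' (~~ i).
  move=> xW oi exy yS; apply: (reg'2 x) => //; rewrite inE yS andbT.
  have [xS xA] := W'SA x xW.
  by apply/negP=> /(Ci _ _ xS xA oi); rewrite exy.
have oN x : o x = i \/ o x = ~~ i by case: (o x) (i) => -[]; auto.
split.
- by rewrite subUset BS andbT; apply/subsetP=> x /W''SB[].
- move=> x xW ox; rewrite /G; case: ifP => [xW'|/negbT xW'].
    have [e1 /(subsetP WB) e2] := reg'1 x xW' ox.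
    by split=> //; rewrite inE e2 orbT.
  case: ifP => [xB|/negbT xB].
    by have [e1 e2 _] := Bi x xB xW' ox; rewrite inE e2 orbT.
  have xW'' : x \in W'' (~~ i) by move: xW; rewrite inE (negbTE xB) orbF.
  by have [e1 e2] := r2 x xW'' ox; rewrite inE e2.
- rewrite negbK => x y /setUP[xW|xB] ox exy yS.
    rewrite inE; have [yB|yB] := boolP (y \in B); first by rewrite orbT.
    by rewrite orbF; apply: (r3 x) => //; rewrite inE yB.
  have [xW'|xW'] := boolP (x \in W' (~~ i)).
    by rewrite inE (subsetP WB) ?orbT //; apply: W'closed exy yS.
  by have [yB _] := Bj x y xB xW' ox exy yS; rewrite inE yB orbT.
move=> w fw.
have wS m : w m \in S.
  by have [/setUP[/W''SB[]//|/(subsetP BS)]] := fw m.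
have [[N NB]|noB] := pselect (exists N, w N \in B); last first.
  apply: r4 => m; have [/setUP[w1|wB] w2 w3] := fw m; last by case: noB; exists m.
  split=> // /w3 ->; have [_ wB] := W''SB _ w1.
  by rewrite /G (contraNF (subsetP WB _) wB) (negbTE wB).
have reach k m : rB (w m) < k -> w m \in B -> exists m', w m' \in W' (~~ i).
  elim: k m => // k IHk m rk wB.
  have [wD|wD] := boolP (w m \in W' (~~ i)); first by exists m.
  have [_ w2 w3] := fw m; have [oi|oi] := oN (w m).
    by have [e1 e2] := Bj _ _ wB wD oi w2 (wS _); apply: (IHk m.+1) => //; apply: leq_trans e2 rk.
  have := Bi _ wB wD oi; have := w3 oi; rewrite /G (negbTE wD) wB => <- [_ e1 e2].
  by apply: (IHk m.+1) => //; apply: leq_trans e2 rk.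
have [N' N'W] := reach _ N (leqnn _) NB.
have stay m : w (N' + m) \in W' (~~ i).
  elim: m => [|m IHm]; first by rewrite addn0.
  have [_ w2 w3] := fw (N' + m); rewrite addnS.
  have [oi|oi] := oN (w (N' + m)); first exact: W'closed IHm oi w2 (wS _).
  by rewrite w3 // /G IHm; have [] := reg'1 _ IHm oi.
apply: (@pwin_tail _ _ N'); apply: reg'3 => m; rewrite addnS.
by have [_ w2 w3] := fw (N' + m); split=> // /w3 ->; rewrite /G stay.
Qed.

End ParityGame.

Lemma ParityE (V : finType) (Om : V -> nat) (w : nat -> V) :
  Parity Om w <-> exists2 q, ~~ odd q & limsup_is (Om \o w) q.
Proof.
split=> [[q [qe [io le]]]|[q qe [io le]]]; exists q => //.
  by split=> // N; have [n [Nn wn]] := io N; exists n.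
by split=> //; split=> // N; have [n Nn wn] := io N; exists n.
Qed.

(** * The product parity game *)

Section Product.
Import mathcomp.boot.fintype mathcomp.boot.finset.
Variables (V : finType) (owner : V -> player) (E : rel V) (Om1 Om2 : V -> nat).

Definition top_prio := \max_(u : V) Om1 u.

Lemma le_top_prio u : Om1 u <= top_prio.
Proof. exact: leq_bigmax. Qed.

(* [(u, m, b)]: the current vertex, the maximal [Om1] since the last flagged
   position, and whether the position is flagged, i.e. either [Om2 u = 2] or
   [u] was reached by Player 2 resolving a random vertex. *)
Definition pos := (V * 'I_top_prio.+1 * bool)%type.
Implicit Types (x : pos) (w : nat -> V).

Definition vertex x : V := x.1.1.
Definition maxprio x : nat := x.1.2.
Definition flag x : bool := x.2.

Definition is_random u := if owner u is Random then true else false.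

Definition init_pos u : pos := (u, inord (Om1 u), Om2 u == 2).

(** The maximum restarts one step after a flag, not at it, so that a flagged position carries the
    maximum of the whole segment it closes. *)
Definition next_pos x (c : bool) y : pos :=
  (y, inord (if flag x then Om1 y else maxn (maxprio x) (Om1 y)),
   (Om2 y == 2) || (is_random (vertex x) && ~~ c)).

(* Every step of the original game takes two moves: from [(x, None)] Player 2
   decides who picks the next vertex (a real choice only at random vertices),
   and in [(x, Some c)] it is picked, by Player 1 iff [c]. *)
Definition state := (pos * option bool)%type.
Implicit Types a b : state.

Definition may_pick (q : player) (c : bool) :=
  match q with Player1 => c | Player2 => ~~ c | Random => true end.

Definition pedge : rel state := fun a b =>
  match a.2, b.2 with
  | None, Some c => (b.1 == a.1) && may_pick (owner (vertex a.1)) c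
  | Some c, None => E (vertex a.1) (vertex b.1) &&
                    (b.1 == next_pos a.1 c (vertex b.1))
  | _, _ => false
  end.

Definition powner a : bool := if a.2 is Some c then ~~ c else true.

(** A flag emits the maximum of its segment, shifted by 2: this keeps the parity and dominates the 1
    of unflagged positions. With finitely many flags the limsup is therefore 1, a loss for Player 1.
    The intermediate states emit the harmless 0. *)
Definition pprio a : nat :=
  if a.2 is Some _ then 0 else if flag a.1 then (maxprio a.1).+2 else 1.

Hypothesis Etotal : forall u, exists y, E u y.

Lemma pedge_total : subarena pedge [set: state].
Proof.
move=> [x [c|]] _.
  have [y Exy] := Etotal (vertex x).
  by exists (next_pos x c y, None); rewrite // /pedge /= Exy /=.
exists (x, Some (if owner (vertex x) is Player2 then false else true)) => //.
by rewrite /pedge /= eqxx /=; case: (owner _).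
Qed.

(** * Lifting a play of the original game to the product *)

Section Track.
(* [kappa x y]: who is considered to have picked [y] in [x]. *)
Variable kappa : pos -> V -> bool.

Definition advance x y := next_pos x (kappa x y) y.

(** [None] is the memory before any vertex is read. The memory holds the position of the previous
    vertex; the current position is computed from it once the current vertex is seen. *)
Definition mem_update (m : option pos) (y : V) : option pos :=
  Some (if m is Some x then advance x y else init_pos y).

Definition pos_after (pre : seq V) (u : V) : pos :=
  odflt (init_pos u) (mem_update (foldl mem_update None pre) u).

Fixpoint track w n : pos :=
  if n is n'.+1 then advance (track w n') (w n) else init_pos (w 0).

Lemma foldl_mem_update pre u :
  foldl mem_update None (rcons pre u) = Some (pos_after pre u).
Proof. by rewrite -cats1 foldl_cat. Qed.

Lemma pos_after_rcons pre u y :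
  pos_after (rcons pre u) y = advance (pos_after pre u) y.
Proof. by rewrite {1}/pos_after foldl_mem_update. Qed.

Lemma vertex_pos_after pre u : vertex (pos_after pre u) = u.
Proof. by rewrite /pos_after /=; case: foldl. Qed.

Lemma prefixS w n : Defs.prefix w n.+1 = rcons (Defs.prefix w n) (w n).
Proof. by rewrite /Defs.prefix -addn1 iotaD map_cat cats1. Qed.

Lemma trackE w n : track w n = pos_after (Defs.prefix w n) (w n).
Proof.
elim: n => [//|n IHn]; rewrite prefixS pos_after_rcons -IHn.
by [].
Qed.

Lemma vertex_track w n : vertex (track w n) = w n.
Proof. by case: n. Qed.

Lemma maxprio_track0 w : maxprio (track w 0) = Om1 (w 0).
Proof. by rewrite /maxprio /= inordK // ltnS le_top_prio. Qed.

Lemma maxprio_trackS w n : maxprio (track w n.+1) =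
  if flag (track w n) then Om1 (w n.+1)
  else maxn (maxprio (track w n)) (Om1 (w n.+1)).
Proof.
rewrite {1}/maxprio /= inordK // ltnS; case: ifP => _; first exact: le_top_prio.
by rewrite geq_max le_top_prio andbT -ltnS ltn_ord.
Qed.

Definition pick_of w n := kappa (track w n) (w n.+1).

Definition pplay w n : state :=
  (track w n./2, if odd n then Some (pick_of w n./2) else None).

Definition flagged_io w := forall N, exists2 n, N <= n & flag (track w n).

Lemma pplay_double w n : pplay w n.*2 = (track w n, None).
Proof. by rewrite /pplay doubleK odd_double. Qed.

Lemma pplay_doubleS w n : pplay w n.*2.+1 = (track w n, Some (pick_of w n)).
Proof. by rewrite /pplay /= uphalf_double odd_double. Qed.

Lemma nat_double n : n = n./2.*2 \/ n = (n./2).*2.+1.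
Proof. by rewrite -{1 3}(odd_double_half n); case: (odd n); auto. Qed.

(** Infinitely many flags cut the play into finite segments, and the limsup of the segment maxima is
    the limsup of [Om1]. *)
Lemma limsup_pplay w q : flagged_io w -> limsup_is (Om1 \o w) q ->
  limsup_is (pprio \o pplay w) q.+2.
Proof.
move=> fio [io [N0 le0]].
have [N1 N01 fN1] := fio N0.
(* After the first flag beyond [N0], no segment contains a priority from before [N0]. *)
have small n : maxprio (track w (N1.+1 + n)) <= q.
  elim: n => [|n IHn]; rewrite ?addn0 ?addnS maxprio_trackS ?fN1.
    by apply: le0; apply: leqW.
  have leq : Om1 (w (N1.+1 + n).+1) <= q by apply: le0; lia.
  by case: ifP => // _; rewrite geq_max IHn.
have small' n : N1 < n -> maxprio (track w n) <= q.
  by move=> lt; have := small (n - N1.+1); rewrite subnKC.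
split=> [N|]; last first.
  exists N1.+1.*2 => n Nn; have lt : N1 < n./2 by lia.
  have := small' _ lt; rewrite /pprio /=; case: (odd n) => //=.
  by case: (flag _) => //= ; rewrite !ltnS.
have [i Ni Omi] := io (N + N1.+1).
have [j ij fj] := fio i.
(* A priority [q] seen at time [i] is remembered until the next flag, which then emits at least
   [q.+2]. The first flag from [i] on is selected below. *)
have large k : i <= k -> (forall l, i <= l < k -> ~~ flag (track w l)) ->
    q <= maxprio (track w k).
  elim: k => [|k IHk].
    by rewrite leqn0 => /eqP i0 _; rewrite maxprio_track0 -i0 -Omi.
  rewrite leq_eqVlt => /orP[/eqP <- _|].
    move: Omi; case: (i) => [|i'] <-; first by rewrite maxprio_track0.
    by rewrite maxprio_trackS; case: ifP => // _; apply: leq_maxr.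
  rewrite ltnS => ik nofl; rewrite maxprio_trackS.
  rewrite (negbTE (nofl k _)) ?ik ?leqnn //.
  apply: leq_trans (leq_maxl _ _); apply: IHk => // l /andP[il lk].
  by apply: nofl; rewrite il (leqW lk).
have exk : exists k, (i <= k) && flag (track w k) by exists j; rewrite ij.
have [k /andP[ik fk] kmin] := ex_minnP exk.
exists k.*2; first by rewrite -addnn; lia.
rewrite /= pplay_double /pprio /= fk; congr _.+2; apply/eqP.
rewrite eqn_leq small' ?large //=; last by lia.
move=> l /andP[il lk]; apply/negP => fl.
by have := kmin l; rewrite il fl /= leqNgt lk => /(_ isT).
Qed.

Lemma limsup_pplay_unflagged w : ~ flagged_io w ->
  limsup_is (pprio \o pplay w) 1.
Proof.
move=> /existsNP[N noN].
have nofl n : N <= n -> flag (track w n) = false.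
  by move=> Nn; apply/negbTE/negP => fl; apply: noN; exists n.
split=> [M|].
  exists (M + N).*2; first by rewrite -addnn; lia.
  by rewrite /= pplay_double /pprio /= nofl // leq_addl.
exists N.*2 => n Nn; rewrite /pprio /=; case: (odd n) => //=.
by rewrite nofl //; lia.
Qed.

Lemma pwin_pplay_even w : pwin pprio false (pplay w) ->
  flagged_io w /\ Parity Om1 w.
Proof.
case=> q qe lq; have [fio|nfio] := pselect (flagged_io w); last first.
  by have q1 := limsup_is_unique lq (limsup_pplay_unflagged nfio); rewrite q1 in qe.
split=> //; apply/ParityE.
have [q' lq'] := @limsup_is_exists (Om1 \o w) top_prio (fun n => le_top_prio _).
exists q' => //; have := limsup_is_unique lq (limsup_pplay fio lq').
by move=> eqq; rewrite eqq /= negbK in qe; rewrite qe.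
Qed.

Lemma pwin_pplay_odd w : pwin pprio true (pplay w) -> Parity Om1 w ->
  ~ flagged_io w.
Proof.
case=> q qo lq /ParityE[q' q'e lq'] fio.
have eqq := limsup_is_unique lq (limsup_pplay fio lq').
by move: q'e; rewrite eqq /= negbK in qo; rewrite qo.
Qed.

End Track.

(** * The strategy of Player 1 obtained from a winning region of the product *)

Section Player1Wins.
Variables (W : {set state}) (f : state -> state).
Hypothesis reg : win_region pedge powner pprio false [set: state] W f.

Definition predicted x : V := vertex (f (x, Some true)).1.

Definition kappa1 x y :=
  match owner (vertex x) with
  | Player1 => true | Player2 => false | Random => predicted x == y end.

Definition some_succ u := odflt u [pick y | E u y].

(** The edge test always succeeds at positions of the winning region that Player 1 owns. Elsewhere
    the prediction may not be a successor, and the fallback keeps the strategy valid. *)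
Definition mem_choice (m : option pos) (u : V) : V :=
  let y := predicted (odflt (init_pos u) (mem_update kappa1 m u)) in
  if E u y then y else some_succ u.

Definition mem_strategy : strategy V :=
  fun pre u => mem_choice (foldl (mem_update kappa1) None pre) u.

Lemma some_succP u : E u (some_succ u).
Proof.
rewrite /some_succ; case: pickP => // no.
by have [y] := Etotal u; rewrite no.
Qed.

Lemma mem_strategy_valid : valid_strategy owner E Player1 mem_strategy.
Proof.
move=> pre u _; rewrite /mem_strategy /mem_choice; case: ifP => // _.
exact: some_succP.
Qed.

Lemma picked_inW x c : (x, None) \in W -> may_pick (owner (vertex x)) c ->
  (x, Some c) \in W.
Proof.
case: reg => _ _ clo _ xW mp; apply: (clo (x, None)) => //.
by rewrite /pedge /= eqxx mp.
Qed.

Lemma predictedP x : (x, None) \in W -> may_pick (owner (vertex x)) true ->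
  E (vertex x) (predicted x) /\
  f (x, Some true) = (next_pos x true (predicted x), None).
Proof.
move=> xW mp; case: reg => _ /(_ (x, Some true) (picked_inW xW mp) erefl) + _ _.
rewrite /predicted; case: (f _) => [x' [c|]] [] //=.
by rewrite /pedge /= => /andP[-> /eqP <-].
Qed.

Lemma mem_strategyE pre u : (pos_after kappa1 pre u, None) \in W ->
  owner u = Player1 -> mem_strategy pre u = predicted (pos_after kappa1 pre u).
Proof.
move=> xW ou; rewrite /mem_strategy /mem_choice -/(pos_after kappa1 pre u).
have := @predictedP _ xW; rewrite vertex_pos_after ou => /(_ isT)[Eu _].
by rewrite Eu.
Qed.

(** One real step is two product moves, both legal for [f]: [kappa1] credits to Player 1 only moves
    that coincide with what [f] prescribes, and all others are moves of the opponent, which cannot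
    leave [W]. *)
Lemma region_step x y : (x, None) \in W -> E (vertex x) y ->
  (owner (vertex x) = Player1 -> y = predicted x) ->
  [/\ pedge (x, None) (x, Some (kappa1 x y)), (x, Some (kappa1 x y)) \in W,
      pedge (x, Some (kappa1 x y)) (advance kappa1 x y, None),
      kappa1 x y -> f (x, Some (kappa1 x y)) = (advance kappa1 x y, None) &
      (advance kappa1 x y, None) \in W].
Proof.
move=> xW Exy yP.
have mp : may_pick (owner (vertex x)) (kappa1 x y).
  by rewrite /kappa1; case: (owner _).
have xcW := picked_inW xW mp.
have pf : kappa1 x y -> f (x, Some (kappa1 x y)) = (advance kappa1 x y, None).
  move=> kxy; rewrite /advance kxy; rewrite kxy in mp.
  have [_ ->] := predictedP xW mp; congr (next_pos x true _, None).
  move: kxy; rewrite /kappa1; case ou: (owner (vertex x)).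
  - by move=> _; rewrite yP.
  - by [].
  - by move=> /eqP.
have e2 : pedge (x, Some (kappa1 x y)) (advance kappa1 x y, None).
  by rewrite /pedge /= Exy /=.
split=> //; first by rewrite /pedge /= eqxx mp.
case: reg => _ clo1 clo2 _; case kxy: (kappa1 x y).
  by rewrite -pf // kxy; have [] := clo1 _ xcW; rewrite /powner /= kxy.
apply: (clo2 (x, Some (kappa1 x y))) => //; first by rewrite /powner /= kxy.
Qed.

(** The lifted play follows [f] inside [W], hence has an even limsup, which gives [Parity Om1]. *)
Lemma mem_strategy_sure v : (init_pos v, None) \in W ->
  sure_winning owner E mem_strategy v (Parity Om1).
Proof.
move=> vW w [w0 wP]; apply: (proj2 (@pwin_pplay_even kappa1 w _)).
have inW n : (track kappa1 w n, None) \in W.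
  elim: n => [|n IHn]; first by rewrite /= w0.
  have [Ew w1] := wP n.
  have [] := @region_step (track kappa1 w n) (w n.+1) IHn; rewrite ?vertex_track //.
  move=> ow; rewrite w1 // trackE mem_strategyE //.
  by rewrite -trackE.
have st n : [/\ pedge (track kappa1 w n, None) (track kappa1 w n, Some (pick_of kappa1 w n)),
    (track kappa1 w n, Some (pick_of kappa1 w n)) \in W,
    pedge (track kappa1 w n, Some (pick_of kappa1 w n)) (track kappa1 w n.+1, None) &
    pick_of kappa1 w n -> f (track kappa1 w n, Some (pick_of kappa1 w n)) =
      (track kappa1 w n.+1, None)].
  have [Ew w1] := wP n.
  have [] := @region_step (track kappa1 w n) (w n.+1) (inW n); rewrite ?vertex_track //.
  move=> ow; rewrite w1 // trackE mem_strategyE //.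
  by rewrite -trackE.
case: reg => _ _ _; apply=> n.
have [e1 e2 e3 e4] := st n./2.
have [->|->] := nat_double n.
  by rewrite pplay_double pplay_doubleS; split.
rewrite -doubleS pplay_double pplay_doubleS; split=> //.
by rewrite /powner /= => /negbFE /e4.
Qed.

(** Once [f] is fixed, no path in [W] avoids flags forever, since its priorities would be 0 and 1
    with 1 recurring. The edges [e'] fix [f], and giving every state to the opponent turns the
    attractor of the flagged states into the set where a flag is unavoidable; its rank is the one
    sought. *)
Lemma flag_rank : exists r : state -> nat, forall a b, a \in W -> b \in W ->
  ~~ flag a.1 -> pedge a b -> (powner a = false -> b = f a) -> r b < r a.
Proof.
pose e' a b := pedge a b && ((powner a == false) ==> (b == f a)).
pose T := [set a in W | flag a.1].
have TW : T \subset W by apply/subsetP => a; rewrite inE => /andP[].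
have [A [r [g [TA AW _ Aj [_ Cj]]]]] := @attractor _ e' (fun=> true) false W T TW.
suff WA : W \subset A.
  exists r => a b aW bW na eab fab; have := Aj a b (subsetP WA a aW).
  rewrite inE aW na => /(_ isT erefl); rewrite /e' eab /=.
  case pa: (powner a) => [|/=]; first by move=> /(_ isT bW)[].
  by rewrite fab // eqxx => /(_ isT)[]//; rewrite -fab.
apply/subsetP => a0 a0W; apply/negPn/negP => a0A.
pose nx a := odflt a [pick b in W :\: A | e' a b].
have nxP a : a \in W :\: A -> nx a \in W :\: A /\ e' a (nx a).
  rewrite /nx => aWA; case: pickP => [b /andP[]//|no].
  move: (aWA); rewrite inE => /andP[aA aW].
  by have [b bWA eab] := Cj a aW aA erefl; have := no b; rewrite bWA eab.
pose w n := iter n nx a0.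
have wWA n : w n \in W :\: A.
  by elim: n => [|n IHn]; [rewrite inE a0A | have [] := nxP _ IHn].
case: reg => _ _ _ /(_ w) [n|q qe [io [N le]]].
  have [_ /andP[e1 e2]] := nxP _ (wWA n); have := wWA n; rewrite inE => /andP[_ wW].
  by split=> // pn; move: e2; rewrite pn eqxx => /eqP.
have wfl n : flag (w n).1 = false.
  have := wWA n; rewrite inE => /andP[wA wW]; apply/negbTE.
  by apply: contraNN wA => fl; apply: (subsetP TA); rewrite inE wW.
have [n Nn wn] := io N.
(* Without flags the only even priority is 0; yet of two consecutive states one has the form
   [(x, None)], with priority 1. *)
have q0 : q = 0.
  by move: qe; rewrite -wn /= /pprio wfl; case: (w n).2.
have [_ /andP[e1 _]] := nxP _ (wWA n); have {}e1 : pedge (w n) (w n.+1) := e1.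
move: (le n Nn) (le n.+1 (leqW Nn)) e1; rewrite q0 /comp /pprio !wfl /pedge.
by case: (w n).2 => // c; case: (w n.+1).2.
Qed.

End Player1Wins.

(** * The counter-strategy of Player 2 and the histories it leaves *)

Section Player2Wins.
Variables (W : {set state}) (g : state -> state).
Hypothesis reg : win_region pedge powner pprio true [set: state] W g.

(** The default is never reached on [W], where [g] must answer along an edge of the product. *)
Definition picker x := if (g (x, None)).2 is Some c then c else true.

Definition kappa2 x (y : V) := picker x.

Definition target x := vertex (g (x, Some false)).1.

Definition spoiler : strategy V := fun pre u =>
  let y := target (pos_after kappa2 pre u) in if E u y then y else some_succ u.

Lemma spoiler_valid : valid_strategy owner E Player2 spoiler.
Proof. by move=> pre u _; rewrite /spoiler; case: ifP => // _; apply: some_succP. Qed.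

Lemma pickerP x : (x, None) \in W ->
  [/\ g (x, None) = (x, Some (picker x)), may_pick (owner (vertex x)) (picker x) &
      (x, Some (picker x)) \in W].
Proof.
case: reg => _ clo _ _ xW; have [] := clo _ xW erefl; rewrite /picker.
case: (g _) => [x' [c|]] //=; rewrite /pedge /= => /andP[/eqP -> mp] x'W.
by split.
Qed.

Lemma targetP x : (x, None) \in W -> picker x = false ->
  E (vertex x) (target x) /\
  g (x, Some false) = (next_pos x false (target x), None).
Proof.
move=> xW px; have [_ _ xpW] := pickerP xW; rewrite px in xpW.
case: reg => _ /(_ _ xpW erefl) + _ _; rewrite /target.
case: (g _) => [x' [c|]] [] //=; rewrite /pedge /= => /andP[-> /eqP <-] _.
by split.
Qed.

Variables (s1 : strategy V) (v : V).
Hypothesis vW : (init_pos v, None) \in W.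

(** Where [g] picks, only its target is kept, even at a random vertex where chance could go
    elsewhere. Such a random step raises a flag, so it does not occur beyond the last one. *)
Definition tree_step (pre : seq V) (u y : V) :=
  [/\ E u y, owner u = Player1 -> y = s1 pre u &
      picker (pos_after kappa2 pre u) = false -> y = target (pos_after kappa2 pre u)].

(* The histories compatible with [s1] and [g], branching at the random vertices
   that [g] leaves to Player 1. *)
Inductive tree : seq V -> V -> Prop :=
| tree_root : tree [::] v
| tree_next pre u y : tree pre u -> tree_step pre u y -> tree (rcons pre u) y.

Lemma tree_inv pre u y : tree (rcons pre u) y -> tree pre u /\ tree_step pre u y.
Proof.
move eqh: (rcons pre u) => h th.
case: h y / th eqh => [|pre' u' y' tr st]; first by case: (pre).
by move=> /rcons_inj[-> ->].
Qed.

Lemma tree_nil u : tree [::] u -> u = v.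
Proof.
move eqh: [::] => h th; case: h u / th eqh => // pre u y _ _ /(congr1 size).
by rewrite size_rcons.
Qed.

Lemma tree_step_region pre u y : (pos_after kappa2 pre u, None) \in W ->
  tree_step pre u y ->
  let x := pos_after kappa2 pre u in
  [/\ pedge (x, Some (picker x)) (advance kappa2 x y, None),
      picker x = false -> g (x, Some (picker x)) = (advance kappa2 x y, None) &
      (advance kappa2 x y, None) \in W].
Proof.
move=> xW [Euy _ yt] x; have [gx mp xpW] := pickerP xW.
have vx : vertex x = u by apply: vertex_pos_after.
have e1 : pedge (x, Some (picker x)) (advance kappa2 x y, None).
  by rewrite /pedge /= vx Euy /=.
have e2 : picker x = false -> g (x, Some (picker x)) = (advance kappa2 x y, None).
  by move=> px; have [_] := targetP xW px; rewrite px /advance /kappa2 -/x px -yt.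
split=> //; case: reg => _ clo1 clo2 _; case px: (picker x); last first.
  by rewrite -e2 //; have [] := clo1 _ xpW; rewrite /powner /= px.
by apply: (clo2 (x, Some (picker x))) => //; rewrite /powner /= px.
Qed.

Lemma tree_inW pre u : tree pre u -> (pos_after kappa2 pre u, None) \in W.
Proof.
elim=> [//|{}pre {}u y tr xW st]; rewrite pos_after_rcons.
by have [] := tree_step_region xW st.
Qed.

Lemma tree_owner2 pre u : tree pre u -> owner u = Player2 ->
  picker (pos_after kappa2 pre u) = false.
Proof.
move=> tr ou; have [_ + _] := pickerP (tree_inW tr).
by rewrite vertex_pos_after ou /=; case: picker.
Qed.

Lemma spoilerE pre u : tree pre u -> picker (pos_after kappa2 pre u) = false ->
  spoiler pre u = target (pos_after kappa2 pre u).
Proof.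
move=> tr px; have [+ _] := targetP (tree_inW tr) px.
by rewrite /spoiler vertex_pos_after => ->.
Qed.

(** A branch is consistent with [s1], hence satisfies [Parity Om1], and with [g], hence has an odd
    limsup in the product. Both can hold only if flags stop. *)
Lemma tree_play_unflagged w : sure_winning owner E s1 v (Parity Om1) ->
  (forall n, tree (Defs.prefix w n) (w n)) -> ~ flagged_io kappa2 w.
Proof.
move=> sure tr.
have st n : tree_step (Defs.prefix w n) (w n) (w n.+1).
  by have := tr n.+1; rewrite prefixS => /tree_inv[].
have inW n : (track kappa2 w n, None) \in W by rewrite trackE; apply: tree_inW.
have w0 : w 0 = v := tree_nil (tr 0).
apply: pwin_pplay_odd; last first.
  by apply: sure; split=> // n; have [e1 e2 _] := st n.
case: reg => _ _ _; apply=> n.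
have [gx mp xpW] := pickerP (inW n./2).
have := tree_step_region; rewrite /= => /(_ _ _ _ _ (st n./2)).
rewrite -trackE => /(_ (inW _))[e1 e2 _].
have [->|->] := nat_double n.
  rewrite pplay_double pplay_doubleS; split=> //.
  by rewrite /pedge /= eqxx.
rewrite -doubleS pplay_double pplay_doubleS; split=> //.
by rewrite /powner /= => /negbTE /e2.
Qed.

(* Otherwise flagged extensions could be chained into a single play with
   infinitely many flags. *)
Lemma tree_last_flag : sure_winning owner E s1 v (Parity Om1) ->
  exists pre u, tree pre u /\ forall t y, tree (rcons pre u ++ t) y ->
    flag (pos_after kappa2 (rcons pre u ++ t) y) = false.
Proof.
move=> sure; apply: contrapT => no.
pose node := {h : seq V * V | tree h.1 h.2}.
have next (h : node) : exists h' : node,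
    (exists t, (sval h').1 = rcons (sval h).1 (sval h).2 ++ t) /\
    flag (pos_after kappa2 (sval h').1 (sval h').2).
  case: h => -[pre u] /= tr; apply: contrapT => noh; apply: no.
  exists pre, u; split=> // t y tr'; apply/negbTE/negP => fl; apply: noh.
  by exists (exist _ (rcons pre u ++ t, y) tr') => /=; split=> //; exists t.
have [nx nxP] := choice next.
pose H n := iter n nx (exist _ ([::], v) tree_root).
pose p n := (sval (H n)).1; pose q n := (sval (H n)).2.
have pS n : exists t, p n.+1 = rcons (p n) (q n) ++ t by have [] := nxP (H n).
have pmono n m : exists t, p (n + m) = p n ++ t.
  elim: m => [|m [t IHm]]; first by exists [::]; rewrite addn0 cats0.
  have [t' e'] := pS (n + m); rewrite addnS e' IHm -cats1 -!catA.
  by eexists; reflexivity.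
have psize n : n <= size (p n).
  elim: n => // n IHn; have [t ->] := pS n.
  by rewrite size_cat size_rcons; apply: leq_trans (leq_addr _ _).
(* The histories [p n] extend one another and [p n] has length at least [n], so letter [i] is
   settled at stage [i.+1]. *)
pose w i := nth v (p i.+1) i.
have wE n i : i < size (p n) -> w i = nth v (p n) i.
  move=> isz; have lt := psize i.+1; rewrite /w.
  have [le|le] := leqP n i.+1.
    by have [t] := pmono n (i.+1 - n); rewrite subnKC // => ->; rewrite nth_cat isz.
  by have [t] := pmono i.+1 (n - i.+1); rewrite subnKC ?(ltnW le) // => ->; rewrite nth_cat lt.
have pE n : Defs.prefix w (size (p n)) = p n.
  apply: (@eq_from_nth _ v); rewrite size_map size_iota // => i isz.
  by rewrite (nth_map 0) ?size_iota // nth_iota // (wE n).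
have qE n : w (size (p n)) = q n.
  have [t e] := pS n; rewrite (wE n.+1) e ?size_cat ?size_rcons ?addSn ?ltnS ?leq_addr //.
  by rewrite nth_cat size_rcons ltnSn nth_rcons ltnn eqxx.
have trn n : tree (Defs.prefix w (size (p n))) (w (size (p n))).
  by rewrite pE qE; apply: (svalP (H n)).
apply: (@tree_play_unflagged w sure).
  move=> n; have := psize n; have := trn n; move: (size (p n)) => k.
  elim: k => [|k IHk]; first by rewrite leqn0 => tr0 /eqP ->.
  move=> tr; rewrite leq_eqVlt => /orP[/eqP -> //|].
  by rewrite ltnS; apply: IHk; move: tr; rewrite prefixS => /tree_inv[].
move=> N; exists (size (p N.+1)); first exact: ltnW (psize N.+1).
by rewrite trackE pE qE; have [] := nxP (H N).
Qed.

End Player2Wins.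

End Product.

(** * Plays as random sequences *)

Section Words.
Variable V : finType.

Fixpoint words n : seq (seq V) :=
  if n is n'.+1 then [seq rcons h y | h <- words n', y <- enum V] else [:: [::]].

Lemma wordsS n : words n.+1 = [seq rcons h y | h <- words n, y <- enum V].
Proof. by []. Qed.

Lemma mem_words n h : (h \in words n) = (size h == n).
Proof.
elim: n h => [|n IHn] h; first by rewrite inE size_eq0.
apply/allpairsP/eqP => [[[h' y] [/= h'n _ ->]]|].
  by rewrite size_rcons; congr _.+1; apply/eqP; rewrite -IHn.
case/lastP: h => [//|h y]; rewrite size_rcons => -[hn].
by exists (h, y); rewrite /= IHn hn eqxx mem_enum.
Qed.

Lemma size_prefix (w : nat -> V) n : size (Defs.prefix w n) = n.
Proof. by rewrite size_map size_iota. Qed.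

Lemma nth_prefix (w : nat -> V) x n i : (i < n)%N -> nth x (Defs.prefix w n) i = w i.
Proof. by move=> lt; rewrite (nth_map 0) ?size_iota // nth_iota. Qed.

Lemma cyl_prefix v (w : @play V v) n : @cyl V v (Defs.prefix w n) w.
Proof. by move=> i; rewrite size_prefix => lt; rewrite nth_prefix. Qed.

Lemma cylP v (h : seq V) (w : @play V v) : @cyl V v h w <-> Defs.prefix w (size h) = h.
Proof.
split=> [cw|eqh]; last by rewrite -{1}eqh; apply: cyl_prefix.
apply: (@eq_from_nth _ v); first by rewrite size_prefix.
move=> i; rewrite size_prefix => lt; rewrite nth_prefix // cw //.
exact: set_nth_default.
Qed.

End Words.
Arguments words : simpl never.

(** * Measurability of the events involved *)

Section Measures.
Import GRing.Theory Num.Theory Order.TTheory.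
Local Open Scope ring_scope.
Local Open Scope classical_set_scope.

Lemma measure_bigsetU_le d (T : measurableType d) (R : realType)
    (mu : {measure set T -> \bar R}) (I : Type) (s : seq I) (Q : pred I)
    (F : I -> set T) : (forall i, measurable (F i)) ->
  (mu (\big[setU/set0]_(i <- s | Q i) F i) <= \sum_(i <- s | Q i) mu (F i))%E.
Proof.
move=> mF; elim: s => [|i s IHs]; first by rewrite !big_nil measure0.
rewrite !big_cons; case: ifP => // _.
apply: (@le_trans _ _ (mu (F i) + mu (\big[setU/set0]_(j <- s | Q j) F j))%E).
  by apply: measureU2 => //; apply: bigsetU_measurable.
by rewrite leeD2l.
Qed.

Context (V : finType) (v : V).
Local Notation T := (g_sigma_algebraType (@cylinders V v)).

Lemma measurable_cyl h : measurable (@cyl V v h : set T).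
Proof. by apply: sub_sigma_algebra; exists h. Qed.

Lemma cover_words (A : set T) n (Q : pred (seq V)) :
  (forall w : T, A w -> Q (Defs.prefix w n)) ->
  A `<=` \big[setU/set0]_(h <- words V n | Q h) (@cyl V v h : set T).
Proof.
move=> AQ w Aw; rewrite -bigcup_seq_cond; exists (Defs.prefix w n) => /=.
  by rewrite mem_words size_prefix eqxx AQ.
exact: cyl_prefix.
Qed.

Lemma measurable_coord n (Q : pred V) : measurable [set w : T | Q (w n)].
Proof.
suff -> : [set w : T | Q (w n)] =
    \big[setU/set0]_(h <- words V n.+1 | Q (nth v h n)) (@cyl V v h : set T).
  by apply: bigsetU_measurable => h _; apply: measurable_cyl.
apply/seteqP; split.
  apply: (@cover_words _ _ (fun h => Q (nth v h n))) => w /= Qw.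
  by rewrite nth_prefix.
move=> w; rewrite -bigcup_seq_cond => -[h /= /andP[]].
rewrite mem_words => /eqP hn Qh /cylP; rewrite hn => eqh.
by rewrite -eqh nth_prefix in Qh.
Qed.

Lemma measurable_never N (Q : pred V) :
  measurable [set w : T | forall i, (N <= i)%N -> Q (w i)].
Proof.
have -> : [set w : T | forall i, (N <= i)%N -> Q (w i)] =
    \bigcap_(i in [set i | (N <= i)%N]) [set w : T | Q (w i)].
  by apply/seteqP; split=> w /= Qw i; apply: Qw.
by apply: bigcap_measurableType => i _; apply: measurable_coord.
Qed.

(** A description by countable operations on coordinate events: it yields measurability, and reduces
    probability one to countably many null events. *)
Lemma buchi_not_never (Om2 : V -> nat) : (forall u, Om2 u = 1%N \/ Om2 u = 2%N) ->
  (Parity Om2 : set T) =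
  ~` \bigcup_N [set w : T | forall i, (N <= i)%N -> Om2 (w i) != 2%N].
Proof.
move=> Om12; apply/seteqP; split=> w.
  move=> [q [qe [io _]]] [N _ /= nev]; have [i [Ni Oi]] := io N.
  have := nev i Ni; rewrite Oi; have [e1|e2] := Om12 (w i).
    by rewrite -Oi e1 in qe.
  by rewrite -Oi e2.
move=> noN; exists 2%N; split=> //; split; last first.
  by exists 0%N => i _; case: (Om12 (w i)) => ->.
move=> N; apply: contrapT => noi; apply: noN; exists N => // i /= Ni.
by apply/eqP => O2; apply: noi; exists i.
Qed.

Lemma measurable_buchi (Om2 : V -> nat) : (forall u, Om2 u = 1%N \/ Om2 u = 2%N) ->
  measurable (Parity Om2 : set T).
Proof.
move=> Om12; rewrite buchi_not_never //; apply: measurableC.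
by apply: bigcup_measurable => N _; apply: (measurable_never _ (fun u => Om2 u != 2%N)).
Qed.

End Measures.

(** * Probabilities of finite histories *)

Section Chain.
Import GRing.Theory Num.Theory Order.TTheory numFieldNormedType.Exports.
Local Open Scope ring_scope.
Context (R : realType) (V : finType) (owner : V -> player) (E : rel V)
  (delta : V -> V -> R).
Hypothesis sg : stoch_game owner E delta.
Variables (s1 s2 : strategy V) (v : V).

Local Notation step := (Defs.step owner delta s1 s2).
Local Notation prob := (prefprob owner delta s1 s2 v).

Lemma step_ge0 pre u y : 0 <= step pre u y.
Proof.
rewrite /Defs.step; case ou: (owner u); rewrite ?ler0n //.
by have [_ /(_ u ou)[]] := sg.
Qed.

Lemma step_sum pre u : \sum_y step pre u y = 1.
Proof.
have single (z : V) : \sum_y (z == y)%:R = 1 :> R.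
  rewrite (bigD1 z) //= eqxx big1 ?addr0 // => y.
  by rewrite eq_sym => /negbTE ->.
rewrite /Defs.step; case ou: (owner u); rewrite ?single //.
by have [_ /(_ u ou)[_ []]] := sg.
Qed.

Lemma step_edge pre u y : valid_strategy owner E Player1 s1 ->
  valid_strategy owner E Player2 s2 -> 0 < step pre u y -> E u y.
Proof.
move=> v1 v2; rewrite /Defs.step; case ou: (owner u).
- by case: eqP => [<-|]; rewrite ?ltxx // => _; apply: v1.
- by case: eqP => [<-|]; rewrite ?ltxx // => _; apply: v2.
- by have [_ /(_ u ou)[_ [-> _]]] := sg.
Qed.

(** Moves of the players have probability 0 or 1, and [delta] has finitely many positive values. *)
Lemma step_lower_bound : exists2 p : R, 0 < p <= 1 &
  forall pre u y, 0 < step pre u y -> p <= step pre u y.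
Proof.
pose p := \big[Num.min/1]_(z : V * V | 0 < delta z.1 z.2) delta z.1 z.2.
have p1 : p <= 1 by apply: bigmin_le_id.
exists p.
  rewrite p1 andbT /p; apply: (big_ind (fun x => 0 < x)) => // x y x0 y0.
  by rewrite lt_min x0.
move=> pre u y; rewrite /Defs.step; case ou: (owner u).
- by case: eqP; rewrite ?ltxx.
- by case: eqP; rewrite ?ltxx.
- by move=> d0; apply: (@bigmin_le_cond _ _ _ 1 (u, y) _ (fun z => delta z.1 z.2)).
Qed.

Lemma prob_rcons pre u y :
  prob (rcons (rcons pre u) y) = prob (rcons pre u) * step pre u y.
Proof.
have [a [t [-> -> ->]]] : exists a t, [/\ rcons pre u = a :: t,
    pre = take (size t) (a :: t) & u = nth a (a :: t) (size t)].
  case: pre => [|a t]; first by exists u, [::].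
  exists a, (rcons t u); split=> //.
    by rewrite size_rcons /= -cats1 take_size_cat.
  by rewrite size_rcons /= nth_rcons ltnn eqxx.
have take_eq k : (k <= size t)%N -> take k (a :: rcons t y) = take k (a :: t).
  by move=> kt; rewrite -rcons_cons -cats1 takel_cat // leqW.
have nth_eq k : (k <= size t)%N -> nth a (a :: rcons t y) k = nth a (a :: t) k.
  by move=> kt; rewrite -rcons_cons nth_rcons ltnS kt.
rewrite [LHS]/= size_rcons big_ord_recr mulrA; congr (_ * _ * _).
  apply: eq_bigr => -[i it] _; rewrite take_eq ?nth_eq ?(ltnW it) //=.
  by rewrite nth_rcons it.
by rewrite take_eq ?nth_eq //= nth_rcons ltnn eqxx.
Qed.

Lemma prob_seq1 u : prob [:: u] = (u == v)%:R.
Proof. by rewrite /= big_ord0 mulr1. Qed.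

Lemma prob_ge0 h : 0 <= prob h.
Proof.
case: h => [|u t]; first by rewrite ler01.
by apply: mulr_ge0; rewrite ?ler0n //; apply: prodr_ge0 => i _; apply: step_ge0.
Qed.

Lemma prob_rcons_gt0 pre u y : 0 < prob (rcons (rcons pre u) y) ->
  0 < prob (rcons pre u) /\ 0 < step pre u y.
Proof.
rewrite prob_rcons => pos.
have pos1 : 0 < prob (rcons pre u).
  rewrite lt_def prob_ge0 andbT; apply: contraTneq pos => ->.
  by rewrite mul0r ltxx.
by split=> //; rewrite -(pmulr_rgt0 _ pos1).
Qed.

Lemma prob_sum h : \sum_y prob (rcons h y) = prob h.
Proof.
case/lastP: h => [|pre u]; last first.
  by under eq_bigr do rewrite prob_rcons; rewrite -mulr_sumr step_sum mulr1.
rewrite (bigD1 v) //= big_ord0 eqxx mulr1 big1 ?addr0 // => y /negbTE.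
by move=> yv; rewrite yv mul0r.
Qed.

(** * Exponential decay of the probability of avoiding priority 2 *)

Section Contraction.
Variables (Om2 : V -> nat) (rank : seq V -> nat) (K : nat).
Hypothesis rankK : forall h, (rank h <= K)%N.
Hypothesis rank_step : forall pre u, 0 < prob (rcons pre u) ->
  exists2 y, 0 < step pre u y &
    Om2 y = 2%N \/ (rank (rcons (rcons pre u) y) < rank (rcons pre u))%N.

Variable p : R.
Hypothesis p01 : 0 < p <= 1.
Hypothesis ple : forall pre u y, 0 < step pre u y -> p <= step pre u y.

(** It increases with the rank, and the exponent [r.+1] keeps it between 1/2 and 1. The base [p / 2]
    is small enough that the drop at one good successor, weighted by [p], pays for all the others
    rising to 1. *)
Definition potential (r : nat) : R := 1 - (p / 2) ^+ r.+1.

Lemma half_p : 0 <= p / 2 /\ p / 2 <= 1 / 2.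
Proof. by case/andP: p01 => p0 p1; split; lra. Qed.

Lemma potential_bounds r : 1 / 2 <= potential r <= 1.
Proof.
have [q0 q1] := half_p; have q11 : p / 2 <= 1 by lra.
have := exprn_ge0 r q0; have := exprn_ile1 r q0 q11.
rewrite /potential exprS => e1 e0; apply/andP; split; nra.
Qed.

(* The potential of the expected next history drops by a fixed factor, histories
   that hit priority 2 counting for nothing. *)
Lemma potential_step pre u : 0 < prob (rcons pre u) ->
  \sum_y step pre u y * ((Om2 y != 2%N)%:R * potential (rank (rcons (rcons pre u) y)))
  <= (1 - (p / 2) ^+ K.+1) * potential (rank (rcons pre u)).
Proof.
move=> pr0; have [y0 st0 good] := rank_step pr0.
set r := rank (rcons pre u) in good *.
have [q0 q1] := half_p; have q11 : p / 2 <= 1 by lra.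
have pb := potential_bounds.
have h0 : (Om2 y0 != 2%N)%:R * potential (rank (rcons (rcons pre u) y0)) <= 1 - (p / 2) ^+ r.
  have e1 : (p / 2) ^+ r <= 1 by apply: exprn_ile1.
  have [->|lt] := good; first by rewrite eqxx mul0r; lra.
  apply: (@le_trans _ _ (potential (rank (rcons (rcons pre u) y0)))).
    case: (Om2 y0 != 2%N); rewrite ?mul1r // mul0r.
    by have /andP[] := pb (rank (rcons (rcons pre u) y0)); lra.
  by rewrite /potential lerD2l lerN2; apply: ler_wiXn2l.
have h1 y : (Om2 y != 2%N)%:R * potential (rank (rcons (rcons pre u) y)) <= 1.
  have /andP[l1 l2] := pb (rank (rcons (rcons pre u) y)).
  by case: (Om2 y != 2%N); rewrite ?mul1r // mul0r ler01.
rewrite (bigD1 y0) //=.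
have le1 : \sum_(y | y != y0) step pre u y *
    ((Om2 y != 2%N)%:R * potential (rank (rcons (rcons pre u) y))) <= 1 - step pre u y0.
  have := step_sum pre u; rewrite (bigD1 y0) //= => /(canRL (addKr _)).
  rewrite addrC => <-.
  apply: ler_sum => y _.
  by rewrite ler_piMr ?step_ge0.
have le0 := ler_wpM2l (step_ge0 pre u y0) h0.
have pst := ple st0.
have qK : (p / 2) ^+ K.+1 <= (p / 2) ^+ r.+1.
  by apply: ler_wiXn2l => //; rewrite ltnS; apply: rankK.
have qr0 : 0 <= (p / 2) ^+ r by apply: exprn_ge0.
have qr1 : (p / 2) ^+ r.+1 = p / 2 * (p / 2) ^+ r by rewrite exprS.
have qK0 : 0 <= (p / 2) ^+ K.+1 by apply: exprn_ge0.
rewrite /potential.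
set a := (p / 2) ^+ r in h0 le0 qr0 qr1 *.
set ar := (p / 2) ^+ r.+1 in qK qr1 *; set aK := (p / 2) ^+ K.+1 in qK qK0 *.
set s := step pre u y0 in le0 le1 pst *.
set X := s * _ in le0 *; set Y := \sum_(_ | _) _ in le1 *.
(* The sum is at most [s * (1 - a) + (1 - s)], hence at most [1 - p * a], which is [1 - 2 * ar]. As
   [aK <= ar], this is below [(1 - aK) * (1 - ar)]. *)
have : p * a <= s * a by apply: ler_wpM2r.
have : 0 <= aK * ar by apply: mulr_ge0 => //; lra.
have : ar = p * a / 2 by rewrite qr1; field.
move=> e1 e2 e3; nra.
Qed.

Definition avoids N (h : seq V) := all (fun y => Om2 y != 2%N) (drop N h).

Lemma avoids_rcons N h y : (N <= size h)%N ->
  avoids N (rcons h y) = avoids N h && (Om2 y != 2%N).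
Proof. by move=> Nh; rewrite /avoids drop_rcons // all_rcons andbC. Qed.

Lemma avoid_sum_step N n : (N <= n)%N -> (0 < n)%N ->
  \sum_(h <- words V n.+1 | avoids N h) prob h * potential (rank h) <=
  (1 - (p / 2) ^+ K.+1) *
  \sum_(h <- words V n | avoids N h) prob h * potential (rank h).
Proof.
move=> Nn n0; rewrite big_mkcond wordsS big_allpairs_dep /= mulr_sumr.
rewrite [leRHS]big_mkcond /= !big_seq; apply: ler_sum => h.
rewrite mem_words => /eqP hn; rewrite big_enum /=.
have Nh : (N <= size h)%N by rewrite hn.
under eq_bigr do rewrite avoids_rcons //.
case: ifP => avh; last by rewrite big1.
case/lastP: h hn avh Nh => [/esym n00|pre u _ _ _]; first by rewrite n00 in n0.
(* The rank hypothesis says nothing about histories of probability zero, but for them both sides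
   vanish. *)
have [pr0|] := ltP 0 (prob (rcons pre u)); last first.
  move=> le0; have pr0 : prob (rcons pre u) = 0.
    by apply/eqP; rewrite eq_le le0 prob_ge0.
  rewrite pr0 mul0r mulr0 big1 // => y _.
  by rewrite prob_rcons pr0 !mul0r if_same.
have := ler_wpM2l (prob_ge0 (rcons pre u)) (potential_step pr0).
rewrite mulrCA mulr_sumr; apply: le_trans.
apply: ler_sum => y _; rewrite andTb prob_rcons -mulrA.
by case: (Om2 y != 2%N); rewrite ?mul1r // !mul0r !mulr0.
Qed.

(** The factor 2 in the constant converts probability to potential, which is at least 1/2. Starting
    at length [N.+1] makes every history nonempty, as the contraction step requires. *)
Lemma avoid_sum_geo N : exists C : R, forall k,
  \sum_(h <- words V (N.+1 + k) | avoids N h) prob h <=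
  C * (1 - (p / 2) ^+ K.+1) ^+ k.
Proof.
pose S n := \sum_(h <- words V n | avoids N h) prob h * potential (rank h).
exists (2 * S N.+1) => k.
have [q0 q1] := half_p; have q11 : p / 2 <= 1 by lra.
have g0 : 0 <= 1 - (p / 2) ^+ K.+1 by rewrite subr_ge0; apply: exprn_ile1.
apply: (@le_trans _ _ (2 * S (N.+1 + k)%N)).
  rewrite /S mulr_sumr; apply: ler_sum => h _.
  have /andP[l1 _] := potential_bounds (rank h); have := prob_ge0 h; nra.
rewrite -mulrA ler_wpM2l //; elim: k => [|k IHk]; first by rewrite addn0 expr0 mulr1.
rewrite addnS; apply: (le_trans (avoid_sum_step _ _)); rewrite ?addSn //; first by lia.
by rewrite [_ ^+ k.+1]exprS mulrCA; apply: ler_wpM2l.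
Qed.

End Contraction.

Local Open Scope classical_set_scope.

(** Avoiding priority 2 from time [N] on is covered, for each [k], by cylinders of total probability
    at most [C * g ^+ k], so it is a null event; the complement of the Büchi event is the union of
    these over [N]. *)
Lemma buchi_of_rank (Om2 : V -> nat) (rank : seq V -> nat) (K : nat)
    (P : probability (g_sigma_algebraType (@cylinders V v)) R) :
  (forall u, Om2 u = 1%N \/ Om2 u = 2%N) ->
  (forall h, (rank h <= K)%N) ->
  (forall pre u, 0 < prob (rcons pre u) ->
    exists2 y, 0 < step pre u y &
      Om2 y = 2%N \/ (rank (rcons (rcons pre u) y) < rank (rcons pre u))%N) ->
  is_Pr owner delta s1 s2 P -> P (Parity Om2) = 1%E.
Proof.
move=> Om12 rankK rank_step isP.
have [p p01 ple] := step_lower_bound.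
have [q0 q1] := half_p p01.
set g : R := 1 - (p / 2) ^+ K.+1.
have g0 : 0 <= g by rewrite subr_ge0; apply: exprn_ile1 => //; lra.
have g1 : g < 1.
  by rewrite /g; have : 0 < (p / 2) ^+ K.+1; [apply: exprn_gt0|]; case/andP: p01; lra.
have never0 N :
    P [set w : g_sigma_algebraType (@cylinders V v) | forall i, (N <= i)%N -> Om2 (w i) != 2%N] = 0%E.
  set A := [set w | _].
  have mA : measurable A by apply: (measurable_never _ (fun u => Om2 u != 2%N)).
  have [C Cle] := avoid_sum_geo rankK rank_step p01 ple N.
  have PA k : (P A <= (C * g ^+ k)%:E)%E.
    apply: (@le_trans _ _
      (P (\big[setU/set0]_(h <- words V (N.+1 + k) | avoids Om2 N h) @cyl V v h))).
      apply: le_measure; rewrite ?inE //.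
        by apply: bigsetU_measurable => h _; apply: measurable_cyl.
      apply: cover_words => w Aw; apply/(all_nthP v) => i.
      rewrite size_drop size_prefix => lt; rewrite nth_drop nth_prefix ?Aw //; lia.
    apply: le_trans (measure_bigsetU_le _ _ _ _) _; first by move=> h; apply: measurable_cyl.
    rewrite (eq_bigr (fun h => (prob h)%:E)) ?sumEFin ?lee_fin //.
    by move=> h _; apply: isP.
  have PAfin : P A \is a fin_num by apply: fin_num_measure.
  rewrite -(fineK PAfin); congr (_%:E); apply/eqP; rewrite eq_le.
  rewrite fine_ge0 // andbT.
  have cv : (C * g ^+ k) @[k --> \oo] --> C * 0.
    by apply: cvgMl_tmp; apply: cvg_expr; rewrite ger0_norm.
  rewrite mulr0 in cv.
  apply: (cvgr_to_ge cv); near=> k.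
  by rewrite -lee_fin fineK.
have mnever := measurable_never _ (fun u => Om2 u != 2%N).
rewrite buchi_not_never // probability_setC; last exact: bigcup_measurable.
rewrite (@measure_negligible _ _ _ P); first by rewrite sube0.
  exact: bigcup_measurable.
apply: negligible_bigcup => N; apply/negligibleP; first exact: mnever.
exact: never0.
Unshelve. all: by end_near. Qed.

End Chain.

(** * Existence of the measure on plays *)

Section PlayMeasure.
Import GRing.Theory Num.Theory Order.TTheory.
Local Open Scope ring_scope.
Local Open Scope classical_set_scope.
Context (R : realType) (V : finType) (v : V) (p : seq V -> R).
Hypothesis p_nil : p [::] = 1.
Hypothesis p_ge0 : forall h, 0 <= p h.
Hypothesis p_sum : forall h, \sum_y p (rcons h y) = p h.

Local Notation T := (g_sigma_algebraType (@cylinders V v)).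

(** Offset of the [k]-th child interval inside the interval of [h], the children being laid side by
    side in the order of [enum V]. *)
Definition cumul (h : seq V) (k : nat) : R :=
  \sum_(0 <= i < k) p (rcons h (nth v (enum V) i)).

Fixpoint left_from (h t : seq V) : R :=
  if t is y :: t' then cumul h (index y (enum V)) + left_from (rcons h y) t' else 0.

(* The play is read off a uniform [x] in [0, 1[: it has prefix [h] iff [x] lies in
   an interval of length [p h] starting at [left h]. *)
Definition left (h : seq V) : R := left_from [::] h.

Definition itv_of (h : seq V) (x : R) := left h <= x < left h + p h.

Lemma cumul_mono h : {homo cumul h : i j / (i <= j)%N >-> i <= j}.
Proof.
move=> i j ij; rewrite /cumul (@big_cat_nat _ _ _ i 0 j) //= lerDl.
by apply: sumr_ge0 => k _; apply: p_ge0.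
Qed.

Lemma cumulS h k : cumul h k.+1 = cumul h k + p (rcons h (nth v (enum V) k)).
Proof. by rewrite /cumul big_nat_recr. Qed.

Lemma cumul_index h y :
  cumul h (index y (enum V)).+1 = cumul h (index y (enum V)) + p (rcons h y).
Proof. by rewrite cumulS nth_index // mem_enum. Qed.

Lemma cumul_total h : cumul h (size (enum V)) = p h.
Proof. by rewrite -p_sum -big_enum (big_nth v). Qed.

Lemma index_lt_enum (y : V) : (index y (enum V) < size (enum V))%N.
Proof. by rewrite index_mem mem_enum. Qed.

Lemma left_rcons h y : left (rcons h y) = left h + cumul h (index y (enum V)).
Proof.
suff gen g : left_from g (rcons h y) = left_from g h + cumul (g ++ h) (index y (enum V)).
  exact: gen.
elim: h g => [|z h IHh] g /=; first by rewrite cats0 addr0 add0r.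
by rewrite IHh cat_rcons addrA.
Qed.

Lemma itv_rcons h y x : itv_of (rcons h y) x -> itv_of h x.
Proof.
rewrite /itv_of left_rcons -addrA -cumul_index => /andP[l1 l2].
have := @cumul_mono h 0 (index y (enum V)) (leq0n _).
have := @cumul_mono h _ _ (index_lt_enum y); rewrite cumul_total {2}/cumul big_geq //.
by move=> le1 le2; apply/andP; split; lra.
Qed.

Lemma itv_disjoint h y z x : itv_of (rcons h y) x -> itv_of (rcons h z) x -> y = z.
Proof.
wlog : y z / (index y (enum V) <= index z (enum V))%N.
  move=> IH iy iz; have [le|/ltnW le] := leqP (index y (enum V)) (index z (enum V)).
    exact: IH.
  by apply/esym/IH.
rewrite leq_eqVlt => /orP[/eqP eqi _ _|lt].
  rewrite -(nth_index v (_ : y \in enum V)) ?mem_enum // eqi nth_index //.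
  by rewrite mem_enum.
rewrite /itv_of !left_rcons -!addrA -!cumul_index => /andP[_ l2] /andP[l3 _].
have le := @cumul_mono h _ _ lt; rewrite -(lerD2l (left h)) in le.
by have := lt_le_trans l2 (le_trans le l3); rewrite ltxx.
Qed.

Lemma itv_cover h x : itv_of h x -> exists y, itv_of (rcons h y) x.
Proof.
move=> /andP[l1 l2].
(* The child containing [x] is the first one whose right end lies beyond [x]; the least [k] found
   here is its index plus one. *)
have exk : exists k, x < left h + cumul h k.
  by exists (size (enum V)); rewrite cumul_total.
have [[|k] xk kmin] := ex_minnP exk.
  by move: xk; rewrite /cumul big_geq // addr0 ltNge l1.
have ksz : (k < size (enum V))%N.
  by apply: kmin; rewrite cumul_total.
have kx : left h + cumul h k <= x.
  by rewrite leNgt; apply/negP => /kmin; rewrite ltnn.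
exists (nth v (enum V) k).
by rewrite /itv_of left_rcons index_uniq ?enum_uniq // kx -addrA -cumulS.
Qed.

Definition next_vertex (h : seq V) (x : R) : V :=
  odflt v [pick y | itv_of (rcons h y) x].

Fixpoint read_hist (x : R) (n : nat) : seq V :=
  if n is n'.+1 then rcons (read_hist x n') (next_vertex (read_hist x n') x) else [::].

Definition read_play (x : R) : T := fun n => next_vertex (read_hist x n) x.

Lemma prefix_read_play x n : Defs.prefix (read_play x) n = read_hist x n.
Proof. by elim: n => // n IHn; rewrite prefixS IHn. Qed.

Lemma itv_read_hist x n : 0 <= x < 1 -> itv_of (read_hist x n) x.
Proof.
move=> x01; elim: n => [|n IHn] /=; first by rewrite /itv_of p_nil add0r.
rewrite /next_vertex; case: pickP => // no.
by have [y] := itv_cover IHn; rewrite no.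
Qed.

Lemma read_hist_itv x h : itv_of h x -> read_hist x (size h) = h.
Proof.
elim/last_ind: h => // h y IHh ihy; rewrite size_rcons /= IHh ?(itv_rcons ihy) //.
congr rcons; rewrite /next_vertex; case: pickP => [z ihz|/(_ y)]; last by rewrite ihy.
exact: itv_disjoint ihz ihy.
Qed.

Lemma itv_unit h x : itv_of h x -> 0 <= x < 1.
Proof.
elim/last_ind: h => [|h y IHh /itv_rcons //]; by rewrite /itv_of p_nil add0r.
Qed.

(** Outside the unit interval no child interval contains [x] and reading falls back on [v], hence
    the intersection. *)
Lemma preimage_cyl h : (`[0, 1[ `&` read_play @^-1` (@cyl V v h) : set R) =
  `[left h, left h + p h[.
Proof.
apply/seteqP; split=> x /=; rewrite !in_itv /=.
  move=> [x01 /cylP]; rewrite prefix_read_play => eqh.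
  by have := itv_read_hist (size h) x01; rewrite eqh.
move=> ih; split; first exact: itv_unit ih.
by apply/cylP; rewrite prefix_read_play read_hist_itv.
Qed.

Lemma measurable_read_play :
  measurable_fun (`[0, 1[ : set (measurableTypeR R)) (read_play : measurableTypeR R -> T).
Proof.
refine (@measurability _ _ (measurableTypeR R) T `[0%R, 1%R[ read_play
  (@cylinders V v) erefl _).
move=> _ [_ [h _ <-] <-].
by rewrite preimage_cyl; apply: measurable_itv.
Qed.

Definition play_prob (A : set T) : \bar R :=
  lebesgue_measure (`[0, 1[ `&` read_play @^-1` A : set (measurableTypeR R)).

Let play_prob0 : play_prob set0 = 0%E.
Proof. by rewrite /play_prob preimage_set0 setI0 measure0. Qed.

Let play_prob_ge0 A : (0 <= play_prob A)%E.
Proof. exact: measure_ge0. Qed.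

Let play_prob_sigma : semi_sigma_additive play_prob.
Proof.
move=> F mF tF mUF; rewrite /play_prob preimage_bigcup setI_bigcupr.
have mG n : measurable (`[0, 1[ `&` read_play @^-1` F n : set (measurableTypeR R)).
  by apply: measurable_read_play => //; apply: measurable_itv.
apply: measure_semi_sigma_additive => //; last exact: bigcup_measurable.
by move=> i j _ _ [x [[_ xi] [_ xj]]]; apply: (tF i j) => //; exists (read_play x).
Qed.

HB.instance Definition _ := isMeasure.Build _ _ _ play_prob
  play_prob0 play_prob_ge0 play_prob_sigma.

Let play_probT : play_prob [set: T] = 1%E.
Proof.
rewrite /play_prob preimage_setT setIT lebesgue_measure_itv /=.
by rewrite lte_fin ltr01 sube0.
Qed.

HB.instance Definition _ := Measure_isProbability.Build _ _ _ play_prob play_probT.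

Lemma play_prob_cyl h : play_prob (@cyl V v h) = (p h)%:E.
Proof.
rewrite /play_prob preimage_cyl lebesgue_measure_itv /= lte_fin.
case: ifPn => [_|]; first by rewrite -EFinB addrC addKr.
rewrite -leNgt gerDl => ple0; congr (_%:E).
by apply/eqP; rewrite eq_le p_ge0.
Qed.

(** Since [almost_sure_winning] quantifies over the measures satisfying [is_Pr], refuting it
    requires such a measure. *)
Lemma play_prob_exists : exists P : probability T R,
  forall h, P (@cyl V v h) = (p h)%:E.
Proof. by exists play_prob; apply: play_prob_cyl. Qed.

End PlayMeasure.

(** * Transfer between the product game and the stochastic game *)

Section Transfer.
Import GRing.Theory Num.Theory Order.TTheory.
Local Open Scope ring_scope.
Context (R : realType) (V : finType) (owner : V -> player) (E : rel V)
  (delta : V -> V -> R) (Om1 Om2 : V -> nat) (v : V).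
Hypothesis sg : stoch_game owner E delta.
Hypothesis Om12 : forall u, Om2 u = 1%N \/ Om2 u = 2%N.

Local Notation state := (state Om1).
Local Notation pedge := (@pedge V owner E Om1 Om2).
Local Notation region i W f :=
  (win_region pedge (@powner V Om1) (@pprio V Om1) i [set: state]%SET W f).

(** From every history of positive probability some possible next vertex has priority 2 or lowers
    the rank towards a flag, so the contraction argument applies. *)
Lemma mem_strategy_almost_sure (W : {set state}) (f : state -> state) :
  region false W f -> (init_pos Om1 Om2 v, None) \in W ->
  almost_sure_winning owner E delta (mem_strategy owner E Om2 f) v (Parity Om2).
Proof.
move=> reg vW s2 s2v P isP; have Etot := proj1 sg.
set s1 := mem_strategy owner E Om2 f in isP *.
have s1v : valid_strategy owner E Player1 s1 by apply: mem_strategy_valid.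
set k1 := kappa1 owner f; pose pa := pos_after owner Om2 k1.
have [r rP] := flag_rank reg.
pose K := (\max_a r a)%N.
have rK a : (r a <= K)%N by apply: leq_bigmax.
(* Flagged positions are placed above all others, so that moving from one to an unflagged position
   also decreases the rank. *)
pose rk (x : pos Om1) := if flag x then K.+1 else r (x, None).
pose rank h := if foldl (mem_update owner Om2 k1) None h is Some x then rk x else 0%N.
have rankE pre u : rank (rcons pre u) = rk (pa pre u).
  by rewrite /rank foldl_mem_update.
have inW pre u : 0 < prefprob owner delta s1 s2 v (rcons pre u) -> (pa pre u, None) \in W.
  elim/last_ind: pre u => [|pre u' IH] u.
    by rewrite prob_seq1; case: eqP => [->|]; rewrite ?ltxx.
  move=> /(prob_rcons_gt0 sg)[/IH xW st]; have Eu := step_edge sg s1v s2v st.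
  rewrite /pa pos_after_rcons -/pa.
  have [||] := region_step reg xW (y := u); rewrite ?vertex_pos_after // => ou.
  move: st; rewrite /step ou /s1 (mem_strategyE reg xW) //.
  by case: eqP => // _; rewrite ltxx.
apply: (@buchi_of_rank _ _ _ _ _ sg s1 s2 v Om2 rank K.+1) => //.
  move=> h; rewrite /rank; case: foldl => // x; rewrite /rk; case: ifP => // _.
  by apply: leqW.
move=> pre u pr0; have xW := inW _ _ pr0.
set x := pa pre u in xW.
have vx : vertex x = u by apply: vertex_pos_after.
(* At a random vertex the predicted successor is taken: it does not count as a deviation, so a flag
   at [y] can only come from [Om2 y = 2]. *)
have [y [st0 Euy y1 nodev]] : exists y, [/\ 0 < step owner delta s1 s2 pre u y,
    E u y, owner u = Player1 -> y = predicted f x &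
    is_random owner u && ~~ k1 x y = false].
  rewrite /step /is_random; case ou: (owner u).
  - exists (s1 pre u); rewrite eqxx ltr01; split=> //; first exact: s1v.
    by move=> _; apply: (mem_strategyE reg).
  - by exists (s2 pre u); rewrite eqxx ltr01; split=> //; exact: s2v.
  - exists (predicted f x); have [|Eup _] := predictedP reg xW; first by rewrite vx ou.
    rewrite vx in Eup; split=> //.
      by have [_ /(_ u ou)[_ [-> _]]] := sg.
    by rewrite /k1 /kappa1 vx ou eqxx.
exists y => //; rewrite !rankE /pa pos_after_rcons -/pa -/x.
have [|left] := eqVneq (Om2 y) 2%N; [by left|right].
have nfl : flag (advance owner Om2 k1 x y) = false.
  by rewrite /advance /next_pos /flag /= (negbTE left) vx.
rewrite {1}/rk nfl; rewrite /rk; case: ifP => [_|/negbT nx]; first by rewrite ltnS.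
have [||e1 W1 e2 fE W2] := region_step reg xW (y := y); rewrite ?vx //.
have lt1 := rP _ _ xW W1 nx e1 ltac:(by []).
apply: ltn_trans lt1; apply: rP => //.
by rewrite /powner /= => /negbFE k; rewrite fE.
Qed.

(** Past the last flagged history of the tree, almost every play stays in the tree and so never sees
    priority 2 again; that history itself has positive probability. *)
Lemma spoiler_wins (W : {set state}) (g : state -> state) (s1 : strategy V) :
  region true W g -> (init_pos Om1 Om2 v, None) \in W ->
  valid_strategy owner E Player1 s1 -> sure_winning owner E s1 v (Parity Om1) ->
  ~ almost_sure_winning owner E delta s1 v (Parity Om2).
Proof.
move=> reg vW s1v sure asw; have Etot := proj1 sg.
pose s2 := spoiler owner E Om2 g.
have s2v : valid_strategy owner E Player2 s2 by apply: spoiler_valid.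
have [P isP] := play_prob_exists v (erefl : prefprob owner delta s1 s2 v [::] = 1)
  (prob_ge0 sg s1 s2 v) (prob_sum sg s1 s2 v).
have P1 : P (Parity Om2) = 1%E by apply: asw isP.
have [pre [u [tr nofl]]] := tree_last_flag reg vW sure.
pose k2 := kappa2 g; pose pa := pos_after owner Om2 k2.
pose prob := prefprob owner delta s1 s2 v.
have tree_prob pre' u' : tree owner E Om2 g s1 v pre' u' -> 0 < prob (rcons pre' u').
  elim=> [|pre1 u1 y tr1 pos1 [Euy y1 y2]]; first by rewrite /prob prob_seq1 eqxx ltr01.
  rewrite /prob prob_rcons mulr_gt0 // /step; case ou: (owner u1).
  - by rewrite y1 // eqxx ltr01.
  - have px := tree_owner2 reg vW tr1 ou.
    by rewrite /s2 (spoilerE reg vW tr1 px) y2 // eqxx ltr01.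
  - by have [_ /(_ u1 ou)[_ [-> _]]] := sg.
(* Extensions of [rcons pre u] that have positive probability stay in the tree. *)
have ext t pre' u' : rcons pre' u' = rcons pre u ++ t -> 0 < prob (rcons pre' u') ->
    tree owner E Om2 g s1 v pre' u'.
  elim/last_ind: t pre' u' => [|t y IH] pre' u'.
    by rewrite cats0 => /rcons_inj[-> ->].
  rewrite -rcons_cat => /rcons_inj[-> ->].
  have [pre1 [u1 e1]] : exists pre1 u1, rcons pre u ++ t = rcons pre1 u1.
    case/lastP: t {IH} => [|t z]; first by exists pre, u; rewrite cats0.
    by exists (rcons pre u ++ t), z; rewrite rcons_cat.
  rewrite e1 => /(prob_rcons_gt0 sg)[pos1 st].
  have tr1 : tree owner E Om2 g s1 v pre1 u1 by apply: IH.
  apply: tree_next => //; split; first exact: (step_edge sg s1v s2v st).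
    by move=> ou; move: st; rewrite /step ou; case: eqP => // _; rewrite ltxx.
  move=> px; case ou: (owner u1).
  - have [_ + _] := pickerP reg (tree_inW reg vW tr1).
    by rewrite vertex_pos_after ou px.
  - move: st; rewrite /step ou /s2 (spoilerE reg vW tr1 px).
    by case: eqP => // _; rewrite ltxx.
  (* The tree could be left only at a random vertex where [g] picks, but then the branch to the
     target of [g] would be flagged, against the choice of [pre] and [u]. *)
  - have [Et _] := targetP reg (tree_inW reg vW tr1) px.
    rewrite vertex_pos_after in Et.
    have tr2 : tree owner E Om2 g s1 v (rcons pre1 u1) (target g (pa pre1 u1)).
      by apply: tree_next => //; split=> // ou1; rewrite ou1 in ou.
    have := nofl t (target g (pa pre1 u1)); rewrite e1 => /(_ tr2).
    rewrite pos_after_rcons /advance /next_pos /flag /= vertex_pos_after.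
    by rewrite /is_random ou /kappa2 px orbT.
pose h := rcons pre u.
(* The play passes through [h] and visits priority 2 at a time [n] beyond it; such a visit would be
   a flag in the tree, so each [B n] is null. *)
pose B n := [set w : g_sigma_algebraType (@cylinders V v) |
  @cyl V v h w /\ (size h <= n)%N /\ Om2 (w n) = 2%N]%classic.
have mB n : measurable (B n).
  have [le|lt] := leqP (size h) n; last first.
    suff -> : B n = set0%classic by [].
    by apply/seteqP; split=> // w [_ []]; rewrite leqNgt lt.
  have -> : B n = (@cyl V v h `&` [set w | Om2 (w n) == 2%N])%classic.
    by apply/seteqP; split=> w [c1]; [case=> _ /eqP|move=> /eqP]; split.
  apply: measurableI; first exact: measurable_cyl.
  exact: (measurable_coord n (fun u => Om2 u == 2%N)).
have B0 n : P (B n) = 0%E.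
  apply/eqP; rewrite -measure_le0.
  pose Q k := [&& (size h <= n)%N, take (size h) k == h & Om2 (nth v k n) == 2%N].
  apply: (@le_trans _ _ (P (\big[setU/set0]_(k <- words V n.+1 | Q k) @cyl V v k)%classic)).
    apply: le_measure; rewrite ?inE //.
      by apply: bigsetU_measurable => k _; apply: measurable_cyl.
    apply: cover_words => w [/cylP ch [hn O2]]; rewrite /Q hn nth_prefix // O2 eqxx andbT /=.
    rewrite -{2}ch; apply/eqP; rewrite /Defs.prefix -map_take take_iota.
    by rewrite (minn_idPl _) // leqW.
  apply: le_trans (measure_bigsetU_le _ _ _ _) _; first by move=> k; apply: measurable_cyl.
  rewrite big_seq_cond big1 // => k.
  rewrite mem_words => /andP[/eqP kn /and3P[hn /eqP kh /eqP O2]].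
  apply: etrans (isP k) _; congr (_%:E); apply/eqP; apply: contraTT isT => nz.
  have pos : 0 < prob k by rewrite lt_def nz (prob_ge0 sg).
  case/lastP: k kn kh O2 pos {nz} => // k y; rewrite size_rcons => -[kn].
  rewrite nth_rcons kn ltnn eqxx => kh O2 pos.
  have ek : rcons k y = rcons (h ++ drop (size h) k) y.
    by rewrite -{1}kh -cats1 takel_cat ?kn // cat_take_drop cats1.
  have trk : tree owner E Om2 g s1 v k y.
    by apply: (ext (rcons (drop (size h) k) y)) => //; rewrite ek rcons_cat.
  move: ek => /rcons_inj[ek]; have := nofl (drop (size h) k) y.
  rewrite -/h -ek => /(_ trk); rewrite /flag.
  have -> : (pos_after owner Om2 (kappa2 g) k y).2 = true; last by [].
  by rewrite /pos_after /=; case: foldl => [x|] /=; rewrite O2 eqxx.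
have hpos : 0 < prob h by apply: tree_prob.
have : (P (Parity Om2) <= P (~` @cyl V v h `|` \bigcup_n B n)%classic)%E.
  apply: le_measure; rewrite ?inE.
  - exact: measurable_buchi.
  - apply: measurableU; last exact: bigcup_measurable.
    by apply: measurableC; apply: measurable_cyl.
  - move=> w Pw; have [ch|nch] := pselect (@cyl V v h w); [right|by left].
    move: Pw => [q [qe [io _]]]; have [n [hn On]] := io (size h); exists n => //.
    split=> //; split=> //; have [e1|e2] := Om12 (w n) => //.
    by rewrite -On e1 in qe.
have mc := @measurable_cyl V v h.
have mU : measurable (\bigcup_n B n)%classic by apply: bigcup_measurable.
have U0 : P (\bigcup_n B n)%classic = 0%E.
  apply: (@measure_negligible _ _ _ P) => //; apply: negligible_bigcup => n.
  by apply/negligibleP; [apply: mB | apply: B0].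
have : (P (~` @cyl V v h `|` \bigcup_n B n) <=
    P (~` @cyl V v h) + P (\bigcup_n B n))%classic%E.
  by apply: measureU2 => //; apply: measurableC.
move=> /[swap] /le_trans /[apply]; rewrite P1 U0 adde0 probability_setC // isP -EFinB lee_fin.
by rewrite lerDl oppr_ge0 leNgt hpos.
Qed.

End Transfer.

Theorem theorem8 :
  exists c : nat,
  forall (R : realType) (V : finType) (owner : V -> player) (E : rel V)
    (delta : V -> V -> R) (Om1 Om2 : V -> nat) (v : V),
    stoch_game owner E delta ->
    (forall u, Om2 u = 1%N \/ Om2 u = 2%N) ->
    (exists s1 : strategy V, valid_strategy owner E Player1 s1 /\
       sure_winning owner E s1 v (Parity Om1) /\
       almost_sure_winning owner E delta s1 v (Parity Om2)) ->
    exists s1 : strategy V, valid_strategy owner E Player1 s1 /\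
       sure_winning owner E s1 v (Parity Om1) /\
       almost_sure_winning owner E delta s1 v (Parity Om2) /\
       uses_memory_at_most owner s1
         (c * #|V| * maxn (\max_(u : V) Om1 u) 1)%N.
Proof.
(* With [n] vertices and top priority [d], [option (pos Om1)] has [2 * n * (d + 1) + 1] elements. As
   [n] is positive this is at most [5 * n * maxn d 1], so 6 is ample. *)
exists 6 => R V owner E delta Om1 Om2 v sg Om12 [s1 [s1v [sure asw]]].
have Etot := proj1 sg.
have [W [f [reg cov]]] := parity_determined (@powner V Om1) (@pprio V Om1)
  (@pedge_total V owner E Om1 Om2 Etot).
have : (init_pos Om1 Om2 v, None) \in W false :|: W true by rewrite cov inE.
rewrite inE => /orP[vW|vW]; last first.
  by case: (spoiler_wins sg Om12 (reg true) vW s1v sure).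
exists (mem_strategy owner E Om2 (f false)); split; first exact: mem_strategy_valid.
split; first exact: (@mem_strategy_sure _ _ _ _ _ _ _ (reg false) v vW).
split; first exact: mem_strategy_almost_sure (reg false) vW.
exists (option (pos Om1)), None, (mem_update owner Om2 (kappa1 owner (f false))),
  (mem_choice owner E Om2 (f false)); split=> //.
have V0 : 0 < #|V| by apply/card_gt0P; exists v.
rewrite card_option !card_prod card_ord card_bool -/(top_prio Om1).
by move: (top_prio Om1) #|V| V0 => d n n0; case: d => [|d]; nia.
Qed.
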